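(* Let $\mathcal{C}$ be a left rigid monoidal category and $X\in\widehat{\mathcal{C}}$. The following properties of $X$ are equivalent: (i) $X$ has a right rigid dual in $\widehat{\mathcal{C}}$; (ii) there exists $\mathbb{D}X\in\widehat{\mathcal{C}}$ such that $\mathbb{D}X\circledast-\colon\widehat{\mathcal{C}}\to\widehat{\mathcal{C}}$ is right adjoint to $X\circledast-\colon\widehat{\mathcal{C}}\to\widehat{\mathcal{C}}$; (iii) $X$ is finitely-generated projective.
   Context: Fix a field $\Bbbk$. All (monoidal) categories and functors are $\Bbbk$-linear and $\mathcal{C}$ is essentially small. $\widehat{\mathcal{C}}=[\mathcal{C},\mathsf{Vect}_\Bbbk]$ is the category of $\Bbbk$-linear functors to vector spaces, with Day convolution $F\circledast G=\int^{a,b}\mathcal{C}(a\otimes b,-)\otimes_\Bbbk Fa\otimes_\Bbbk Gb$ as tensor product and $\mathcal{C}(1,-)$ as unit. In a monoidal category, a right rigid dual of $x$ is an object $x^\vee$ with morphisms $\mathrm{ev}\colon x\otimes x^\vee\to1$ and $\mathrm{coev}\colon1\to x^\vee\otimes x$ satisfying $\mathrm{id}_x=(\mathrm{ev}\otimes\mathrm{id}_x)(\mathrm{id}_x\otimes\mathrm{coev})$ and $\mathrm{id}_{x^\vee}=(\mathrm{id}_{x^\vee}\otimes\mathrm{ev})(\mathrm{coev}\otimes\mathrm{id}_{x^\vee})$. A left rigid dual of $x$ is an object ${}^\vee x$ with morphisms ${}^\vee x\otimes x\to1$ and $1\to x\otimes{}^\vee x$ satisfying the analogous identities. $\mathcal{C}$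 is left rigid if every object has a left rigid dual. A functor in $\widehat{\mathcal{C}}$ is finitely generated if it is a quotient of a finite direct sum of representable functors $\mathcal{C}(x,-)$. *)

(* Defs.v *)
From HB Require Import structures.
From mathcomp Require Import all_boot all_order all_algebra.
From mathcomp Require Import boolp.

Set Implicit Arguments.
Unset Strict Implicit.
Unset Printing Implicit Defensive.
Import GRing.Theory.
Local Open Scope ring_scope.
Local Open Scope quotient_scope.

Declare Scope moncat_scope.
Delimit Scope moncat_scope with M.
Local Open Scope moncat_scope.

Record category := Category {
  obj :> Type;
  hom : obj -> obj -> Type;
  idm : forall a, hom a a;
  comp : forall a b c, hom b c -> hom a b -> hom a c;
  comp1m : forall a b (f : hom a b), comp (idm b) f = f;
  compm1 : forall a b (f : hom a b), comp f (idm a) = f;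
  compA : forall a b c d (f : hom c d) (g : hom b c) (h : hom a b),
    comp f (comp g h) = comp (comp f g) h }.

Arguments hom {c} _ _ : rename.
Arguments idm {c} a : rename.
Arguments comp {c a b c0} f g : rename.
Notation "f ∘ g" := (comp f g) (at level 40, left associativity) : moncat_scope.

Record iso (C : category) (a b : C) := Iso {
  ihom : hom a b;
  iinv : hom b a;
  ihomK : iinv ∘ ihom = idm a;
  iinvK : ihom ∘ iinv = idm b }.

Arguments ihom {C a b} _.
Arguments iinv {C a b} _.

Definition epi (C : category) (a b : C) (e : hom a b) :=
  forall c (f g : hom b c), f ∘ e = g ∘ e -> f = g.

Definition projective (C : category) (p : C) :=
  forall (a b : C) (e : hom a b), epi e ->
  forall f : hom p b, exists g : hom p a, e ∘ g = f.

Record functor (C D : category) := Functor {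
  fun_obj :> C -> D;
  fun_hom : forall a b, hom a b -> hom (fun_obj a) (fun_obj b);
  fun_id : forall a, fun_hom (idm a) = idm (fun_obj a);
  fun_comp : forall a b c (f : hom b c) (g : hom a b),
    fun_hom (f ∘ g) = fun_hom f ∘ fun_hom g }.

Arguments fun_hom {C D} _ {a b} _.

Record adjunction (C D : category) (L : functor C D) (R : functor D C) :=
  Adjunction {
  adj : forall c d, hom (L c) d -> hom c (R d);
  adj_inv : forall c d, hom c (R d) -> hom (L c) d;
  adjK : forall c d, cancel (@adj c d) (@adj_inv c d);
  adj_invK : forall c d, cancel (@adj_inv c d) (@adj c d);
  adj_nat : forall c c' d d' (u : hom c' c) (v : hom d d') (f : hom (L c) d),
    adj (v ∘ f ∘ fun_hom L u) = fun_hom R v ∘ adj f ∘ u }.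

Definition right_adjoint (C D : category) (R : functor D C) (L : functor C D) :=
  inhabited (adjunction L R).

Record monoidal (C : category) := Monoidal {
  tens : C -> C -> C;
  tensm : forall a a' b b', hom a a' -> hom b b' -> hom (tens a b) (tens a' b');
  tunit : C;
  massoc : forall a b c, iso (tens (tens a b) c) (tens a (tens b c));
  munitl : forall a, iso (tens tunit a) a;
  munitr : forall a, iso (tens a tunit) a;
  tensm1 : forall a b, tensm (idm a) (idm b) = idm (tens a b);
  tensm_comp : forall a a' a'' b b' b''
    (f' : hom a' a'') (f : hom a a') (g' : hom b' b'') (g : hom b b'),
    tensm (f' ∘ f) (g' ∘ g) = tensm f' g' ∘ tensm f g;
  massoc_nat : forall a a' b b' c c'
    (f : hom a a') (g : hom b b') (h : hom c c'),
    ihom (massoc a' b' c') ∘ tensm (tensm f g) h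
    = tensm f (tensm g h) ∘ ihom (massoc a b c);
  munitl_nat : forall a a' (f : hom a a'),
    ihom (munitl a') ∘ tensm (idm tunit) f = f ∘ ihom (munitl a);
  munitr_nat : forall a a' (f : hom a a'),
    ihom (munitr a') ∘ tensm f (idm tunit) = f ∘ ihom (munitr a);
  mpentagon : forall a b c d,
    tensm (idm a) (ihom (massoc b c d)) ∘ ihom (massoc a (tens b c) d)
      ∘ tensm (ihom (massoc a b c)) (idm d)
    = ihom (massoc a b (tens c d)) ∘ ihom (massoc (tens a b) c d);
  mtriangle : forall a b,
    tensm (idm a) (ihom (munitl b)) ∘ ihom (massoc a tunit b)
    = tensm (ihom (munitr a)) (idm b) }.

Arguments tens {C} _ _ _.
Arguments tensm {C} _ {a a' b b'} _ _.
Arguments tunit {C} _.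
Arguments massoc {C} _ _ _ _.
Arguments munitl {C} _ _.
Arguments munitr {C} _ _.

Section Rigid.
Variables (C : category) (M : monoidal C).
Local Notation "a ⊗ b" := (tens M a b) (at level 35, right associativity).
Local Notation "f ⊠ g" := (tensm M f g) (at level 35, right associativity).

Record right_dual_data (x y : C) := RightDual {
  rd_ev : hom (x ⊗ y) (tunit M);
  rd_coev : hom (tunit M) (y ⊗ x);
  rd_zigzag :
    ihom (munitl M x) ∘ (rd_ev ⊠ idm x) ∘ iinv (massoc M x y x)
      ∘ (idm x ⊠ rd_coev) ∘ iinv (munitr M x) = idm x;
  rd_zagzig :
    ihom (munitr M y) ∘ (idm y ⊠ rd_ev) ∘ ihom (massoc M y x y)
      ∘ (rd_coev ⊠ idm y) ∘ iinv (munitl M y) = idm y }.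

Definition is_right_dual (x y : C) := inhabited (right_dual_data x y).

(* A left dual y of x has y ⊗ x -> 1 and 1 -> x ⊗ y with the zig-zag
   identities, i.e. the data making x a right dual of y. *)
Definition is_left_dual (x y : C) := is_right_dual y x.

Definition left_rigid := forall x : C, exists y : C, is_left_dual x y.

Definition tens_functor (x : C) : functor C C.
Proof.
refine (@Functor C C (tens M x) (fun a b f => idm x ⊠ f) _ _).
- by move=> a; rewrite tensm1.
- by move=> a b c f g; rewrite -tensm_comp comp1m.
Defined.

End Rigid.

Record lincat (k : fieldType) := Lincat {
  lobj : Type;
  lhom : lobj -> lobj -> lmodType k;
  lidm : forall a, lhom a a;
  lcomp : forall a b c, lhom b c -> lhom a b -> lhom a c;
  lcomp1m : forall a b (f : lhom a b), lcomp (lidm b) f = f;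
  lcompm1 : forall a b (f : lhom a b), lcomp f (lidm a) = f;
  lcompA : forall a b c d (f : lhom c d) (g : lhom b c) (h : lhom a b),
    lcomp f (lcomp g h) = lcomp (lcomp f g) h;
  lcomp_linl : forall a b c (g : lhom a b),
    linear (fun f : lhom b c => lcomp f g);
  lcomp_linr : forall a b c (f : lhom b c),
    linear (fun g : lhom a b => lcomp f g) }.

Arguments lhom {k l} _ _ : rename.

Coercion cat_of_lincat k (C : lincat k) : category :=
  @Category (lobj C) (fun a b => lhom a b) (@lidm k C) (@lcomp k C)
    (@lcomp1m k C) (@lcompm1 k C) (@lcompA k C).

(* Essential smallness is a condition on universe levels: no bound is imposed on
   the level of the type of objects, but [rep_index] has to be at most the level
   of the carriers of [lmodType]s (forced by its use in [day] below). *)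
Record ess_small (C : category) := EssSmall {
  rep_index : Type;
  rep : rep_index -> C;
  rep_surj : forall x : C, exists i, inhabited (iso (rep i) x) }.

Arguments rep {C e} _ : rename.

Record lmoncat (k : fieldType) := Lmoncat {
  lmc_lincat :> lincat k;
  lmc_monoidal :> monoidal lmc_lincat;
  tensm_linl : forall (a a' b b' : lmc_lincat) (g : lhom b b'),
    linear (fun f : lhom a a' => tensm lmc_monoidal f g : lhom _ _);
  tensm_linr : forall (a a' b b' : lmc_lincat) (f : lhom a a'),
    linear (fun g : lhom b b' => tensm lmc_monoidal f g : lhom _ _);
  lmc_small : ess_small lmc_lincat }.

Record psh (k : fieldType) (C : lincat k) := Psh {
  pobj :> C -> lmodType k;
  pmap : forall a b : C, lhom a b -> pobj a -> pobj b;
  pmap_lin : forall (a b : C) (f : lhom a b), linear (pmap f);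
  pmap_linl : forall (a b : C) (x : pobj a),
    linear (fun f : lhom a b => pmap f x);
  pmap1 : forall (a : C) (x : pobj a), pmap (lidm a) x = x;
  pmap_comp : forall (a b c : C) (f : lhom b c) (g : lhom a b) (x : pobj a),
    pmap (lcomp f g) x = pmap f (pmap g x) }.

Arguments pmap {k C} _ {a b} _ _.

Record nat_trans (k : fieldType) (C : lincat k) (F G : psh C) := NatTrans {
  nt :> forall a : C, F a -> G a;
  nt_lin : forall a : C, linear (@nt a);
  nt_nat : forall (a b : C) (f : lhom a b) (x : F a),
    nt (pmap F f x) = pmap G f (nt x) }.

Lemma nat_trans_eq k (C : lincat k) (F G : psh C) (s t : nat_trans F G) :
  (forall a x, s a x = t a x) -> s = t.
Proof.
case: s t => [s sl sn] [t tl tn] /= E.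
have E' : s = t by apply: functional_extensionality_dep => a;
  apply: functional_extensionality_dep => x; exact: E.
by subst t; congr NatTrans; exact: Prop_irrelevance.
Qed.

Section PshCat.
Variables (k : fieldType) (C : lincat k).

Definition nt_id (F : psh C) : nat_trans F F.
Proof. by refine (@NatTrans k C F F (fun a x => x) _ _). Defined.

Definition nt_comp (F G H : psh C) (s : nat_trans G H) (t : nat_trans F G) :
  nat_trans F H.
Proof.
refine (@NatTrans k C F H (fun a x => s a (t a x)) _ _).
- by move=> a r u v; rewrite !nt_lin.
- by move=> a b f x; rewrite !nt_nat.
Defined.

Definition psh_cat : category.
Proof.
refine (@Category (psh C) (@nat_trans k C) nt_id nt_comp _ _ _).
- by move=> F G s; apply: nat_trans_eq.
- by move=> F G s; apply: nat_trans_eq.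
- by move=> F G H K s t u; apply: nat_trans_eq.
Defined.

Definition yoneda (x : C) : psh C.
Proof.
refine (@Psh k C (fun a => lhom x a) (fun a b f g => lcomp f g) _ _ _ _).
- by move=> a b f; exact: lcomp_linr.
- by move=> a b g; exact: lcomp_linl.
- by move=> a g; exact: lcomp1m.
- by move=> a b c f g h; rewrite lcompA.
Defined.

Definition psh_sum (F G : psh C) : psh C.
Proof.
refine (@Psh k C (fun a => (F a * G a)%type)
  (fun a b f x => (pmap F f x.1, pmap G f x.2)) _ _ _ _).
- by move=> a b f r [x y] [x' y'] /=; rewrite !pmap_lin.
- by move=> a b [x y] r f g /=; rewrite !pmap_linl.
- by move=> a [x y] /=; rewrite !pmap1.
- by move=> a b c f g [x y] /=; rewrite !pmap_comp.
Defined.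

Definition psh_zero : psh C.
Proof.
refine (@Psh k C (fun a => 'rV[k]_0) (fun a b f x => x) _ _ _ _) => //.
by move=> a b x r f g; rewrite !(flatmx0, thinmx0).
Defined.

Definition sum_yoneda (s : seq C) : psh C :=
  foldr (fun x F => psh_sum (yoneda x) F) psh_zero s.

Definition finitely_generated (X : psh_cat) :=
  exists (s : seq C) (e : @hom psh_cat (sum_yoneda s) X), epi e.

End PshCat.

(* [pmod bal] is the universal recipient of a map [f] out of [T] satisfying
   [bal]: formal linear combinations of elements of [T], two of them being
   identified when every map satisfying [bal] evaluates them equally. *)

Inductive lincomb (k : Type) (T : Type) :=
| LGen of T
| LZero
| LAdd of lincomb k T & lincomb k T
| LScale of k & lincomb k T.
Arguments LZero {k T}.
Arguments LGen {k T}.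

HB.instance Definition _ k T := gen_eqMixin (lincomb k T).
HB.instance Definition _ k T := gen_choiceMixin (lincomb k T).

Fixpoint leval (k : fieldType) T (V : lmodType k) (f : T -> V)
    (t : lincomb k T) : V :=
  match t with
  | LGen g => f g
  | LZero => 0
  | LAdd t u => leval f t + leval f u
  | LScale a t => a *: leval f t
  end.

Section Presented.
Variables (k : fieldType) (T : Type).
Variable bal : forall V : lmodType k, (T -> V) -> Prop.

Definition lin_eqb (s t : lincomb k T) :=
  `[< forall (V : lmodType k) (f : T -> V), bal f -> leval f s = leval f t >].

Lemma lin_eqb_equiv : equiv_class_of lin_eqb.
Proof.
split.
- by move=> t; apply/asboolP.
- by move=> s t; apply/asboolP/asboolP => E V f bf; rewrite E.
- move=> t s u /asboolP E1 /asboolP E2; apply/asboolP => V f bf.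
  by rewrite E1 ?E2.
Qed.

Canonical lin_eqb_rel := EquivRelPack lin_eqb_equiv.

Definition pmod := {eq_quot lin_eqb}.
HB.instance Definition _ : EqQuotient _ lin_eqb pmod := EqQuotient.on pmod.
HB.instance Definition _ := Choice.on pmod.

Lemma pmod_eqP s t :
  (forall (V : lmodType k) (f : T -> V), bal f -> leval f s = leval f t) ->
  \pi_pmod s = \pi_pmod t.
Proof. by move=> E; apply/eqquotP/asboolP. Qed.

Lemma leval_repr (V : lmodType k) (f : T -> V) t : bal f ->
  leval f (repr (\pi_pmod t)) = leval f t.
Proof.
move=> bf; have /eqquotP/asboolP := reprK (\pi_pmod t).
exact.
Qed.

Definition pmod_add (x y : pmod) := \pi_pmod (LAdd (repr x) (repr y)).
Definition pmod_scale (a : k) (x : pmod) := \pi_pmod (LScale a (repr x)).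
Definition pmod_opp (x : pmod) := pmod_scale (- 1) x.
Definition pmod_zero : pmod := \pi_pmod LZero.

Lemma pmod_repr_eq (x y : pmod) :
  (forall (V : lmodType k) (f : T -> V), bal f ->
     leval f (repr x) = leval f (repr y)) -> x = y.
Proof. by move=> E; rewrite -(reprK x) -(reprK y); apply: pmod_eqP. Qed.

Local Ltac pm :=
  move=> *; apply: pmod_repr_eq => ???;
  rewrite /pmod_opp /pmod_scale /pmod_add /pmod_zero;
  do 3 ?[rewrite !leval_repr //=].

Lemma pmod_addA : associative pmod_add.
Proof. by pm; rewrite addrA. Qed.
Lemma pmod_addC : commutative pmod_add.
Proof. by pm; rewrite addrC. Qed.
Lemma pmod_add0 : left_id pmod_zero pmod_add.
Proof. by pm; rewrite add0r. Qed.
Lemma pmod_addN : left_inverse pmod_zero pmod_opp pmod_add.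
Proof. by pm; rewrite scaleN1r addNr. Qed.

HB.instance Definition _ :=
  GRing.isZmodule.Build pmod pmod_addA pmod_addC pmod_add0 pmod_addN.

Lemma pmod_scaleA a b v : pmod_scale a (pmod_scale b v) = pmod_scale (a * b) v.
Proof. by pm; rewrite scalerA. Qed.
Lemma pmod_scale1 : left_id 1 pmod_scale.
Proof. by pm; rewrite scale1r. Qed.
Lemma pmod_scaleDr : right_distributive pmod_scale +%R.
Proof. by pm; rewrite scalerDr. Qed.
Lemma pmod_scaleDl v : {morph pmod_scale^~ v : a b / a + b}.
Proof. by pm; rewrite scalerDl. Qed.

HB.instance Definition _ := GRing.Zmodule_isLmodule.Build k pmod
  pmod_scaleA pmod_scale1 pmod_scaleDr pmod_scaleDl.

Lemma leval_reprD (V : lmodType k) (f : T -> V) (x y : pmod) : bal f ->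
  leval f (repr (x + y)) = leval f (repr x) + leval f (repr y).
Proof. exact: (@leval_repr V f (LAdd _ _)). Qed.

Lemma leval_reprZ (V : lmodType k) (f : T -> V) a (x : pmod) : bal f ->
  leval f (repr (a *: x)) = a *: leval f (repr x).
Proof. exact: (@leval_repr V f (LScale _ _)). Qed.

Definition pgen (g : T) : pmod := \pi_pmod (LGen g).
Definition plift (V : lmodType k) (f : T -> V) (x : pmod) : V := leval f (repr x).

Lemma plift_gen (V : lmodType k) (f : T -> V) g : bal f ->
  plift f (pgen g) = f g.
Proof. by move=> bf; rewrite /plift leval_repr. Qed.

Lemma plift_lin (V : lmodType k) (f : T -> V) : bal f -> linear (plift f).
Proof. by move=> bf a x y; rewrite /plift leval_reprD // leval_reprZ. Qed.

Lemma pmod_ext (x y : pmod) :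
  (forall (V : lmodType k) (f : T -> V), bal f -> plift f x = plift f y) ->
  x = y.
Proof. exact: pmod_repr_eq. Qed.

Lemma pmod_ind (P : pmod -> Prop) :
  P 0 -> (forall x y, P x -> P y -> P (x + y)) ->
  (forall a x, P x -> P (a *: x)) -> (forall g, P (pgen g)) -> forall x, P x.
Proof.
move=> P0 PD PZ PG x; rewrite -(reprK x).
elim: (repr x) => [g||t IHt u IHu|a t IHt]; first exact: PG.
- exact: P0.
- have -> : \pi_pmod (LAdd t u) = \pi_pmod t + \pi_pmod u; last exact: PD.
  by apply: pmod_repr_eq => V f bf; rewrite leval_reprD // !leval_repr.
- have -> : \pi_pmod (LScale a t) = a *: \pi_pmod t; last exact: PZ.
  by apply: pmod_repr_eq => V f bf; rewrite leval_reprZ // !leval_repr.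
Qed.

End Presented.

Section LinearFacts.
Variables (k : fieldType) (U V : lmodType k) (f : U -> V) (lf : linear f).

Lemma linear_add x y : f (x + y) = f x + f y.
Proof. by rewrite -{1}[x]scale1r lf scale1r. Qed.

Lemma linear_zero : f 0 = 0.
Proof. by apply: (addrI (f 0)); rewrite -linear_add !addr0. Qed.

Lemma linear_scale a x : f (a *: x) = a *: f x.
Proof. by rewrite -[a *: x]addr0 lf linear_zero addr0. Qed.

End LinearFacts.

Section MonoidalFacts.
Variables (C : category) (M : monoidal C).
Local Notation "a ⊗ b" := (tens M a b) (at level 35, right associativity).
Local Notation "f ⊠ g" := (tensm M f g) (at level 35, right associativity).

Lemma iso_swap (a b a' b' : C) (i : iso a b) (j : iso a' b')
    (f : hom a a') (g : hom b b') :
  ihom j ∘ f = g ∘ ihom i -> iinv j ∘ g = f ∘ iinv i.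
Proof.
move=> E; rewrite -[iinv j ∘ g]compm1 -(iinvK i) !compA -[_ ∘ g ∘ _]compA -E.
by rewrite compA ihomK comp1m.
Qed.

Lemma iinv_assoc_nat (a a' b b' c c' : C)
    (f : hom a a') (g : hom b b') (h : hom c c') :
  iinv (massoc M a' b' c') ∘ (f ⊠ g ⊠ h)
  = ((f ⊠ g) ⊠ h) ∘ iinv (massoc M a b c).
Proof. exact/iso_swap/massoc_nat. Qed.

Lemma iinv_unitl_nat (a a' : C) (f : hom a a') :
  iinv (munitl M a') ∘ f = (idm (tunit M) ⊠ f) ∘ iinv (munitl M a).
Proof. exact/iso_swap/munitl_nat. Qed.

Lemma iinv_unitr_nat (a a' : C) (f : hom a a') :
  iinv (munitr M a') ∘ f = (f ⊠ idm (tunit M)) ∘ iinv (munitr M a).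
Proof. exact/iso_swap/munitr_nat. Qed.

Lemma tensm_compl (a a' a'' b : C) (f : hom a' a'') (g : hom a a') :
  (f ∘ g) ⊠ idm b = (f ⊠ idm b) ∘ (g ⊠ idm b).
Proof. by rewrite -tensm_comp comp1m. Qed.

Lemma tensm_compr (a b b' b'' : C) (f : hom b' b'') (g : hom b b') :
  idm a ⊠ (f ∘ g) = (idm a ⊠ f) ∘ (idm a ⊠ g).
Proof. by rewrite -tensm_comp comp1m. Qed.

Lemma tensm_split (a a' b b' : C) (f : hom a a') (g : hom b b') :
  f ⊠ g = (f ⊠ idm b') ∘ (idm a ⊠ g).
Proof. by rewrite -tensm_comp comp1m compm1. Qed.

Lemma tensm_swap (a a' b b' : C) (f : hom a a') (g : hom b b') :
  (f ⊠ idm b') ∘ (idm a ⊠ g) = (idm a' ⊠ g) ∘ (f ⊠ idm b).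
Proof. by rewrite -!tensm_comp !comp1m !compm1. Qed.

Lemma inv_unique (a b : C) (f : hom a b) (g h : hom b a) :
  g ∘ f = idm a -> f ∘ h = idm b -> g = h.
Proof. by move=> E1 E2; rewrite -[g]compm1 -E2 compA E1 comp1m. Qed.

Lemma pentagon_inv (a b c d : C) :
  (iinv (massoc M a b c) ⊠ idm d) ∘ iinv (massoc M a (b ⊗ c) d)
    ∘ (idm a ⊠ iinv (massoc M b c d))
  = iinv (massoc M (a ⊗ b) c d) ∘ iinv (massoc M a b (c ⊗ d)).
Proof.
apply: (@inv_unique _ _
  (ihom (massoc M a b (c ⊗ d)) ∘ ihom (massoc M (a ⊗ b) c d))).
- rewrite -mpentagon !compA -[_ ∘ (idm a ⊠ _) ∘ (idm a ⊠ _)]compA.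
  rewrite -tensm_compr ihomK tensm1 compm1.
  rewrite -[_ ∘ iinv _ ∘ ihom _]compA ihomK compm1.
  by rewrite -tensm_compl ihomK tensm1.
- rewrite !compA -[_ ∘ ihom _ ∘ iinv _]compA iinvK compm1.
  by rewrite iinvK.
Qed.

Lemma triangle_inv (a b : C) :
  iinv (massoc M a (tunit M) b) ∘ (idm a ⊠ iinv (munitl M b))
  = iinv (munitr M a) ⊠ idm b.
Proof.
apply: (@inv_unique _ _ (ihom (munitr M a) ⊠ idm b)).
- rewrite -mtriangle !compA -[_ ∘ (idm a ⊠ _) ∘ (idm a ⊠ _)]compA.
  by rewrite -tensm_compr ihomK tensm1 compm1 ihomK.
- by rewrite -tensm_compl iinvK tensm1.
Qed.

End MonoidalFacts.

Section Day.
Variables (k : fieldType) (C : lmoncat k).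
Let ess : ess_small C := lmc_small C.

Local Notation "a ⊗ b" := (tens C a b) (at level 35, right associativity).
Local Notation "f ⊠ g" := (tensm C f g) (at level 35, right associativity).
Local Notation "f ∘ g" := (@comp C _ _ _ f g) : moncat_scope.
Local Notation Hom := (@lhom k C).
Local Notation rp := (@rep C ess).
Local Notation id := (@idm C _).

Lemma pmapD (F : psh C) (a b : C) (f : Hom a b) x y :
  pmap F f (x + y) = pmap F f x + pmap F f y.
Proof. exact/linear_add/pmap_lin. Qed.

Lemma pmap0 (F : psh C) (a b : C) (f : Hom a b) : pmap F f 0 = 0.
Proof. exact/linear_zero/pmap_lin. Qed.

Lemma pmap_compE (F : psh C) (a b c : C) (f : Hom b c) (g : Hom a b) x :
  pmap F (f ∘ g) x = pmap F f (pmap F g x).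
Proof. exact: pmap_comp. Qed.

Lemma pmap_id (F : psh C) (a : C) x : pmap F (idm a) x = x.
Proof. exact: pmap1. Qed.

Lemma comp_linl (a b c : C) (g : Hom a b) :
  linear (fun f : Hom b c => f ∘ g : Hom a c).
Proof. exact: lcomp_linl. Qed.

Lemma comp_linr (a b c : C) (f : Hom b c) :
  linear (fun g : Hom a b => f ∘ g : Hom a c).
Proof. exact: lcomp_linr. Qed.

Definition rep_of (x : C) : {i : rep_index ess & iso (rp i) x} :=
  let: exist i p := cid (rep_surj ess x) in
  existT _ i (inhabited_witness p).

Section DayModule.
Variables (F G : psh C) (c : C).

(* (F ⊛ G) c is the coend of C(a ⊗ b, c) ⊗ F a ⊗ G b over a, b: it is generated
   by triples (f, x, y), which are to be linear in each entry (the tensor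
   products over k) and dinatural in a and b. The coend is taken over the small
   set of representatives of the objects; [day_mk], [day_rec] and their
   properties below are the corresponding statements over all objects. *)
Record day_gen := DayGen {
  dg_a : rep_index ess;
  dg_b : rep_index ess;
  dg_hom : Hom (rp dg_a ⊗ rp dg_b) c;
  dg_l : F (rp dg_a);
  dg_r : G (rp dg_b) }.

Definition day_balanced (V : lmodType k) (beta : day_gen -> V) : Prop :=
  [/\ forall i j (x : F (rp i)) (y : G (rp j)),
        linear (fun f : Hom (rp i ⊗ rp j) c => beta (DayGen f x y)),
      forall i j (f : Hom (rp i ⊗ rp j) c) (y : G (rp j)),
        linear (fun x : F (rp i) => beta (DayGen f x y)),
      forall i j (f : Hom (rp i ⊗ rp j) c) (x : F (rp i)),
        linear (fun y : G (rp j) => beta (DayGen f x y)) &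
      forall i i' j j' (u : Hom (rp i) (rp i')) (v : Hom (rp j) (rp j'))
          (f : Hom (rp i' ⊗ rp j') c) (x : F (rp i)) (y : G (rp j)),
        beta (DayGen (f ∘ (u ⊠ v)) x y)
        = beta (DayGen f (pmap F u x) (pmap G v y)) ].

Definition day_mod : lmodType k := pmod day_balanced.

Definition day_mk (a b : C) (f : Hom (a ⊗ b) c) (x : F a) (y : G b) : day_mod :=
  let: existT i p := rep_of a in
  let: existT j q := rep_of b in
  pgen day_balanced
    (DayGen (f ∘ (ihom p ⊠ ihom q)) (pmap F (iinv p) x) (pmap G (iinv q) y)).

Lemma day_mk_linh (a b : C) x y : linear (fun f : Hom (a ⊗ b) c => day_mk f x y).
Proof.
rewrite /day_mk; case: (rep_of a) => i p; case: (rep_of b) => j q r f g.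
apply: pmod_ext => V beta bb; rewrite plift_lin // !plift_gen //.
by case: bb => L _ _ _; rewrite comp_linl L.
Qed.

Lemma day_mk_linl (a b : C) (f : Hom (a ⊗ b) c) y : linear (fun x => day_mk f x y).
Proof.
rewrite /day_mk; case: (rep_of a) => i p; case: (rep_of b) => j q r x x'.
apply: pmod_ext => V beta bb; rewrite plift_lin // !plift_gen //.
by case: bb => _ L _ _; rewrite pmap_lin L.
Qed.

Lemma day_mk_linr (a b : C) (f : Hom (a ⊗ b) c) x : linear (fun y => day_mk f x y).
Proof.
rewrite /day_mk; case: (rep_of a) => i p; case: (rep_of b) => j q r y y'.
apply: pmod_ext => V beta bb; rewrite plift_lin // !plift_gen //.
by case: bb => _ _ L _; rewrite pmap_lin L.
Qed.

Lemma day_mk_nat (a a' b b' : C) (u : Hom a a') (v : Hom b b')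
    (f : Hom (a' ⊗ b') c) x y :
  day_mk (f ∘ (u ⊠ v)) x y = day_mk f (pmap F u x) (pmap G v y).
Proof.
rewrite /day_mk; case: (rep_of a) => i p; case: (rep_of b) => j q.
case: (rep_of a') => i' p'; case: (rep_of b') => j' q'.
apply: pmod_ext => V beta bb; rewrite !plift_gen //.
case: bb => _ _ _ N.
have -> : f ∘ (u ⊠ v) ∘ (ihom p ⊠ ihom q) = f ∘ (ihom p' ⊠ ihom q')
    ∘ ((iinv p' ∘ u ∘ ihom p) ⊠ (iinv q' ∘ v ∘ ihom q)).
  by rewrite -!compA -!tensm_comp !compA !iinvK !comp1m.
rewrite N -!pmap_compE -!compA !iinvK !compm1.
by rewrite !pmap_compE.
Qed.

Lemma pgen_day_mk (g : day_gen) :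
  pgen day_balanced g = day_mk (dg_hom g) (dg_l g) (dg_r g).
Proof.
case: g => a b f x y /=.
rewrite /day_mk; case: (rep_of _) => i p; case: (rep_of _) => j q.
apply: pmod_ext => V beta bb; rewrite !plift_gen //.
case: bb => _ _ _ N.
by rewrite N -!pmap_compE !iinvK !pmap_id.
Qed.

Lemma day_ind (P : day_mod -> Prop) :
  P 0 -> (forall s t, P s -> P t -> P (s + t)) ->
  (forall a b (f : Hom (a ⊗ b) c) x y, P (day_mk f x y)) -> forall s, P s.
Proof.
move=> P0 PD PG s.
suff: forall r : k, P (r *: s) by move/(_ 1); rewrite scale1r.
elim/pmod_ind: s => [r|s t Ps Pt r|a s Ps r|g r].
- by rewrite scaler0.
- by rewrite scalerDr; apply: PD.
- by rewrite scalerA.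
- by rewrite pgen_day_mk -(linear_scale (day_mk_linh _ _)).
Qed.

Section Rec.
Variables (V : lmodType k) (beta : forall a b, Hom (a ⊗ b) c -> F a -> G b -> V).
Hypothesis beta_linh : forall a b x y, linear (fun f => @beta a b f x y).
Hypothesis beta_linl : forall a b f y, linear (fun x => @beta a b f x y).
Hypothesis beta_linr : forall a b f x, linear (fun y => @beta a b f x y).
Hypothesis beta_nat : forall a a' b b' (u : Hom a a') (v : Hom b b') f x y,
  beta (f ∘ (u ⊠ v)) x y = beta f (pmap F u x) (pmap G v y).

Definition day_rec : day_mod -> V :=
  plift (fun g : day_gen => beta (dg_hom g) (dg_l g) (dg_r g)).

Let bal : day_balanced (fun g : day_gen => beta (dg_hom g) (dg_l g) (dg_r g)).
Proof.
split=> [i j x y|i j f y|i j f x|i i' j j' u v f x y].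
- exact: (beta_linh x y).
- exact: (beta_linl f y).
- exact: (beta_linr f x).
- exact: beta_nat.
Qed.

Lemma day_rec_lin : linear day_rec.
Proof. exact: plift_lin bal. Qed.

Lemma day_recE (a b : C) (f : Hom (a ⊗ b) c) x y :
  day_rec (day_mk f x y) = beta f x y.
Proof.
rewrite /day_mk; case: (rep_of a) => i p; case: (rep_of b) => j q.
by rewrite /day_rec plift_gen //= beta_nat -!pmap_compE !iinvK !pmap_id.
Qed.

End Rec.

End DayModule.

Arguments day_mk {F G c a b} f x y.

Section DayFunctor.
Variables (F G : psh C).

Definition day_map (c d : C) (h : Hom c d) : day_mod F G c -> day_mod F G d :=
  day_rec (fun a b f x y => day_mk (h ∘ f) x y).

Lemma day_map_lin (c d : C) (h : Hom c d) : linear (day_map h).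
Proof.
apply: day_rec_lin => [a b x y r f g|a b f y|a b f x|a a' b b' u v f x y].
- by rewrite comp_linr day_mk_linh.
- exact: day_mk_linl.
- exact: day_mk_linr.
- by rewrite compA day_mk_nat.
Qed.

Lemma day_map_mk (c d a b : C) (h : Hom c d) (f : Hom (a ⊗ b) c) x y :
  day_map h (day_mk f x y) = day_mk (h ∘ f) x y.
Proof.
apply: day_recE => [? ? ? ? r ? ?|? ? ? ?|? ? ? ?|a' a'' b' b'' u v g x' y'].
- by rewrite comp_linr day_mk_linh.
- exact: day_mk_linl.
- exact: day_mk_linr.
- by rewrite compA day_mk_nat.
Qed.

Definition day : psh C.
Proof.
refine (@Psh k C (day_mod F G) day_map day_map_lin _ _ _).
- move=> a b s r f g; elim/day_ind: s => [|s t Es Et|a' b' h x y].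
  + by rewrite !(linear_zero (day_map_lin _)) scaler0 addr0.
  + by rewrite !(linear_add (day_map_lin _)) Es Et scalerDr addrACA.
  + by rewrite !day_map_mk comp_linl day_mk_linh.
- move=> a s; elim/day_ind: s => [|s t Es Et|a' b' h x y].
  + exact: linear_zero (day_map_lin _).
  + by rewrite (linear_add (day_map_lin _)) Es Et.
  + by rewrite day_map_mk comp1m.
- move=> a b c f g s; elim/day_ind: s => [|s t Es Et|a' b' h x y].
  + by rewrite !(linear_zero (day_map_lin _)).
  + by rewrite !(linear_add (day_map_lin _)) Es Et.
  + by rewrite !day_map_mk compA.
Defined.

Lemma pmap_day_mk (c d a b : C) (h : Hom c d) (f : Hom (a ⊗ b) c) x y :
  pmap day h (day_mk f x y) = day_mk (h ∘ f) x y.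
Proof. exact: day_map_mk. Qed.

End DayFunctor.

Local Notation "F ⊛ G" := (day F G) (at level 35, right associativity).

Lemma nt_compE (F G H : psh C) (s : nat_trans G H) (t : nat_trans F G) a x :
  (@comp (psh_cat C) F G H s t : nat_trans F H) a x = s a (t a x).
Proof. by []. Qed.

Lemma nt_idE (F : psh C) a x : (@idm (psh_cat C) F : nat_trans F F) a x = x.
Proof. by []. Qed.

Lemma nat_linD (F G : psh C) (s : nat_trans F G) (a : C) (x y : F a) :
  s a (x + y) = s a x + s a y.
Proof. exact/linear_add/nt_lin. Qed.

Lemma nat_lin0 (F G : psh C) (s : nat_trans F G) (a : C) : s a 0 = 0.
Proof. exact/linear_zero/nt_lin. Qed.

Lemma day_ext (F G H : psh C) (s t : nat_trans (F ⊛ G) H) :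
  (forall (a b c : C) (f : Hom (a ⊗ b) c) x y,
     s c (day_mk f x y) = t c (day_mk f x y)) -> s = t.
Proof.
move=> E; apply: nat_trans_eq => c; elim/day_ind => [|u v Eu Ev|a b f x y].
- by rewrite !nat_lin0.
- by rewrite !nat_linD Eu Ev.
- exact: E.
Qed.

Lemma day_mkDl (F G : psh C) (a b c : C) (f : Hom (a ⊗ b) c) x x' y :
  day_mk f (x + x') y = day_mk f x y + day_mk f x' y :> (F ⊛ G) c.
Proof. exact: (linear_add (day_mk_linl _ _)). Qed.

Lemma day_mkDr (F G : psh C) (a b c : C) (f : Hom (a ⊗ b) c) x y y' :
  day_mk f x (y + y') = day_mk f x y + day_mk f x y' :> (F ⊛ G) c.
Proof. exact: (linear_add (day_mk_linr _ _)). Qed.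

Lemma day_mk0l (F G : psh C) (a b c : C) (f : Hom (a ⊗ b) c) y :
  day_mk f 0 y = 0 :> (F ⊛ G) c.
Proof. exact: (linear_zero (day_mk_linl _ _)). Qed.

Lemma day_mk0r (F G : psh C) (a b c : C) (f : Hom (a ⊗ b) c) x :
  day_mk f x 0 = 0 :> (F ⊛ G) c.
Proof. exact: (linear_zero (day_mk_linr _ _)). Qed.

Lemma day_mk_natl (F G : psh C) (a a' b c : C) (u : Hom a a')
    (f : Hom (a' ⊗ b) c) x y :
  day_mk f (pmap F u x) y = day_mk (f ∘ (u ⊠ id)) x y :> (F ⊛ G) c.
Proof. by rewrite day_mk_nat pmap_id. Qed.

Lemma day_mk_natr (F G : psh C) (a b b' c : C) (v : Hom b b')
    (f : Hom (a ⊗ b') c) x y :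
  day_mk f x (pmap G v y) = day_mk (f ∘ (id ⊠ v)) x y :> (F ⊛ G) c.
Proof. by rewrite day_mk_nat pmap_id. Qed.

Lemma day_mk_mkl (F G H : psh C) (a b c d e : C) (f : Hom (d ⊗ c) e)
    (g : Hom (a ⊗ b) d) x y z :
  day_mk f (day_mk g x y : (F ⊛ G) d) z
  = day_mk (f ∘ (g ⊠ id)) (day_mk id x y : (F ⊛ G) _) z :> ((F ⊛ G) ⊛ H) e.
Proof. by rewrite -day_mk_natl pmap_day_mk compm1. Qed.

Lemma day_mk_mkr (F G H : psh C) (a b c d e : C) (f : Hom (a ⊗ d) e)
    (g : Hom (b ⊗ c) d) x y z :
  day_mk f x (day_mk g y z : (G ⊛ H) d)
  = day_mk (f ∘ (id ⊠ g)) x (day_mk id y z : (G ⊛ H) _) :> (F ⊛ G ⊛ H) e.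
Proof. by rewrite -day_mk_natr pmap_day_mk compm1. Qed.

Section DayLift.
Variables (F G H : psh C) (phi : forall a b : C, F a -> G b -> H (a ⊗ b)).
Hypothesis phi_linl : forall a b y, linear (fun x => @phi a b x y).
Hypothesis phi_linr : forall a b x, linear (fun y => @phi a b x y).
Hypothesis phi_nat : forall a a' b b' (u : Hom a a') (v : Hom b b') x y,
  phi (pmap F u x) (pmap G v y) = pmap H (u ⊠ v) (phi x y).

Let lift (c : C) : (F ⊛ G) c -> H c :=
  day_rec (fun a b f x y => pmap H f (phi x y)).

Let liftP (c : C) :
  linear (@lift c) /\ forall (a b : C) (f : Hom (a ⊗ b) c) x y,
    lift (day_mk f x y) = pmap H f (phi x y).
Proof.
have H1 : forall a b x y, linear (fun f : Hom (a ⊗ b) c => pmap H f (phi x y)).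
  by move=> *; apply: pmap_linl.
have H2 : forall a b (f : Hom (a ⊗ b) c) y, linear (fun x => pmap H f (phi x y)).
  by move=> a b f y r x x'; rewrite phi_linl pmap_lin.
have H3 : forall a b (f : Hom (a ⊗ b) c) x, linear (fun y => pmap H f (phi x y)).
  by move=> a b f x r y y'; rewrite phi_linr pmap_lin.
have H4 : forall a a' b b' (u : Hom a a') (v : Hom b b') (f : Hom (a' ⊗ b') c) x y,
    pmap H (f ∘ (u ⊠ v)) (phi x y) = pmap H f (phi (pmap F u x) (pmap G v y)).
  by move=> *; rewrite pmap_compE phi_nat.
split; first exact: day_rec_lin H1 H2 H3 H4.
by move=> *; apply: day_recE.
Qed.

Definition day_lift : nat_trans (F ⊛ G) H.
Proof.
refine (@NatTrans k C (F ⊛ G) H lift (fun c => proj1 (liftP c)) _).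
move=> c d h; elim/day_ind => [|s t Es Et|a b f x y].
- by rewrite pmap0 !(linear_zero (proj1 (liftP _)))
    pmap0.
- by rewrite pmapD !(linear_add (proj1 (liftP _))) pmapD Es Et.
- by rewrite pmap_day_mk !(proj2 (liftP _)) pmap_compE.
Defined.

Lemma day_liftE (a b c : C) (f : Hom (a ⊗ b) c) x y :
  day_lift c (day_mk f x y) = pmap H f (phi x y).
Proof. exact: (proj2 (liftP c)). Qed.

End DayLift.

Section DayHom.
Variables (F F' G G' : psh C) (s : nat_trans F F') (t : nat_trans G G').

Let P1 (a b : C) y : linear (fun x : F a =>
  day_mk (idm (a ⊗ b)) (s a x) (t b y) : (F' ⊛ G') _).
Proof. by move=> r x x'; rewrite nt_lin day_mk_linl. Qed.
Let P2 (a b : C) x : linear (fun y : G b =>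
  day_mk (idm (a ⊗ b)) (s a x) (t b y) : (F' ⊛ G') _).
Proof. by move=> r y y'; rewrite nt_lin day_mk_linr. Qed.
Let P3 (a a' b b' : C) (u : Hom a a') (v : Hom b b') x y :
  day_mk (idm (a' ⊗ b')) (s a' (pmap F u x)) (t b' (pmap G v y))
  = pmap (F' ⊛ G') (u ⊠ v) (day_mk (idm (a ⊗ b)) (s a x) (t b y)).
Proof. by rewrite !nt_nat -day_mk_nat pmap_day_mk comp1m compm1. Qed.

Definition day_hom : nat_trans (F ⊛ G) (F' ⊛ G') := day_lift P1 P2 P3.

Lemma day_homE (a b c : C) (f : Hom (a ⊗ b) c) x y :
  day_hom c (day_mk f x y) = day_mk f (s a x) (t b y).
Proof. by rewrite day_liftE pmap_day_mk compm1. Qed.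

End DayHom.

Lemma day_ext3l (F G H K : psh C) (s t : nat_trans ((F ⊛ G) ⊛ H) K) :
  (forall (a b c d e : C) (f : Hom (d ⊗ c) e) (g : Hom (a ⊗ b) d) x y z,
     s e (day_mk f (day_mk g x y : (F ⊛ G) d) z)
     = t e (day_mk f (day_mk g x y : (F ⊛ G) d) z)) -> s = t.
Proof.
move=> E; apply: day_ext => d c e f x z.
elim/day_ind: x => [|u v Eu Ev|a b g x y].
- by rewrite day_mk0l !nat_lin0.
- by rewrite day_mkDl !nat_linD Eu Ev.
- exact: E.
Qed.

Lemma day_ext3r (F G H K : psh C) (s t : nat_trans (F ⊛ G ⊛ H) K) :
  (forall (a b c d e : C) (f : Hom (a ⊗ d) e) (g : Hom (b ⊗ c) d) x y z,
     s e (day_mk f x (day_mk g y z : (G ⊛ H) d))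
     = t e (day_mk f x (day_mk g y z : (G ⊛ H) d))) -> s = t.
Proof.
move=> E; apply: day_ext => a d e f x z.
elim/day_ind: z => [|u v Eu Ev|b c g y z].
- by rewrite day_mk0r !nat_lin0.
- by rewrite day_mkDr !nat_linD Eu Ev.
- exact: E.
Qed.

Lemma day_ext4l (F G H K L : psh C) (s t : nat_trans (((F ⊛ G) ⊛ H) ⊛ K) L) :
  (forall (a b c d p q e : C) (f : Hom (q ⊗ d) e) (g : Hom (p ⊗ c) q)
      (h : Hom (a ⊗ b) p) x y z w,
     s e (day_mk f (day_mk g (day_mk h x y : (F ⊛ G) p) z : ((F ⊛ G) ⊛ H) q) w)
     = t e (day_mk f (day_mk g (day_mk h x y : (F ⊛ G) p) z : ((F ⊛ G) ⊛ H) q) w))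
  -> s = t.
Proof.
move=> E; apply: day_ext3l => p c d q e f g x z w.
elim/day_ind: x => [|u v Eu Ev|a b h x y].
- by rewrite day_mk0l day_mk0l !nat_lin0.
- by rewrite day_mkDl day_mkDl !nat_linD Eu Ev.
- exact: E.
Qed.

Section Assoc.
Variables (F G H : psh C).
Local Notation al a b c := (ihom (massoc C a b c)).
Local Notation ai a b c := (iinv (massoc C a b c)).

Let val (d c : C) (s : (F ⊛ G) d) (z : H c) : (F ⊛ G ⊛ H) (d ⊗ c) :=
  day_rec (fun a b g x y =>
    day_mk ((g ⊠ id) ∘ ai a b c) x (day_mk id y z : (G ⊛ H) _)) s.

Let valP (d c : C) (z : H c) : linear (fun s => @val d c s z) /\
  forall (a b : C) (g : Hom (a ⊗ b) d) x y,
  val (day_mk g x y) z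
  = day_mk ((g ⊠ id) ∘ ai a b c) x (day_mk id y z : (G ⊛ H) _).
Proof.
pose beta (a b : C) (g : Hom (a ⊗ b) d) x y : (F ⊛ G ⊛ H) (d ⊗ c) :=
  day_mk ((g ⊠ id) ∘ ai a b c) x (day_mk id y z : (G ⊛ H) _).
have H1 : forall a b x y, linear (fun g => @beta a b g x y).
  move=> a b x y r f g; rewrite /beta.
  by rewrite (tensm_linl (idm c : Hom c c)) comp_linl day_mk_linh.
have H2 : forall a b g y, linear (fun x => @beta a b g x y).
  by move=> a b g y; apply: day_mk_linl.
have H3 : forall a b g x, linear (fun y => @beta a b g x y).
  by move=> a b g x r y y'; rewrite /beta day_mk_linl day_mk_linr.
have H4 : forall a a' b b' (u : Hom a a') (v : Hom b b') f x y,
    @beta a b (f ∘ (u ⊠ v)) x y = @beta a' b' f (pmap F u x) (pmap G v y).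
  move=> a a' b b' u v f x y; rewrite /beta.
  rewrite (day_mk_natl (F := G)) comp1m [in RHS]day_mk_mkr day_mk_natl.
  by rewrite tensm_compl -!compA -iinv_assoc_nat -tensm_comp comp1m compm1.
split; first exact: day_rec_lin H1 H2 H3 H4.
by move=> a b g x y; apply: (@day_recE F G d _ beta).
Qed.

Let A1 (d c : C) z : linear (fun s => @val d c s z).
Proof. exact (proj1 (@valP d c z)). Qed.

Let valE (a b c d : C) (z : H c) (g : Hom (a ⊗ b) d) x y :
  val (day_mk g x y) z
  = day_mk ((g ⊠ id) ∘ ai a b c) x (day_mk id y z : (G ⊛ H) _).
Proof. exact (proj2 (@valP d c z) a b g x y). Qed.

Let A2 (d c : C) s : linear (fun z => @val d c s z).
Proof.
elim/day_ind: s => [|s t Es Et|a b g x y] r z z'.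
- by rewrite !(linear_zero (A1 _)) scaler0 addr0.
- by rewrite !(linear_add (A1 _)) Es Et scalerDr addrACA.
- by rewrite !valE day_mk_linr day_mk_linr.
Qed.

Let A3 (d d' c c' : C) (u : Hom d d') (v : Hom c c') s z :
  val (pmap (F ⊛ G) u s) (pmap H v z) = pmap (F ⊛ G ⊛ H) (u ⊠ v) (val s z).
Proof.
elim/day_ind: s => [|s t Es Et|a b g x y].
- by rewrite pmap0 !(linear_zero (A1 _))
    pmap0.
- by rewrite pmapD !(linear_add (A1 _)) pmapD Es Et.
- rewrite pmap_day_mk !valE pmap_day_mk.
  rewrite day_mk_natr comp1m [in LHS]day_mk_mkr; congr day_mk.
  rewrite -!compA iinv_assoc_nat !compA; congr (_ ∘ _).
  by rewrite tensm1 -!tensm_comp !comp1m !compm1.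
Qed.

Definition day_assoc : nat_trans ((F ⊛ G) ⊛ H) (F ⊛ G ⊛ H) := day_lift A1 A2 A3.

Lemma day_assocE (a b c d e : C) (f : Hom (d ⊗ c) e) (g : Hom (a ⊗ b) d) x y z :
  day_assoc e (day_mk f (day_mk g x y : (F ⊛ G) d) z)
  = day_mk (f ∘ (g ⊠ id) ∘ ai a b c) x (day_mk id y z : (G ⊛ H) _).
Proof. by rewrite day_liftE valE pmap_day_mk compA. Qed.

Let wal (a d : C) (x : F a) (s : (G ⊛ H) d) : ((F ⊛ G) ⊛ H) (a ⊗ d) :=
  day_rec (fun b c g y z =>
    day_mk ((id ⊠ g) ∘ al a b c) (day_mk id x y : (F ⊛ G) _) z) s.

Let walP (a d : C) (x : F a) : linear (fun s => @wal a d x s) /\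
  forall (b c : C) (g : Hom (b ⊗ c) d) y z,
  wal x (day_mk g y z)
  = day_mk ((id ⊠ g) ∘ al a b c) (day_mk id x y : (F ⊛ G) _) z.
Proof.
pose beta (b c : C) (g : Hom (b ⊗ c) d) y z : ((F ⊛ G) ⊛ H) (a ⊗ d) :=
  day_mk ((id ⊠ g) ∘ al a b c) (day_mk id x y : (F ⊛ G) _) z.
have H1 : forall b c y z, linear (fun g => @beta b c g y z).
  move=> b c y z r f g; rewrite /beta.
  by rewrite (tensm_linr (idm a : Hom a a)) comp_linl day_mk_linh.
have H2 : forall b c g z, linear (fun y => @beta b c g y z).
  by move=> b c g z r y y'; rewrite /beta day_mk_linr day_mk_linl.
have H3 : forall b c g y, linear (fun z => @beta b c g y z).
  by move=> b c g y; apply: day_mk_linr.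
have H4 : forall b b' c c' (u : Hom b b') (v : Hom c c') f y z,
    @beta b c (f ∘ (u ⊠ v)) y z = @beta b' c' f (pmap G u y) (pmap H v z).
  move=> b b' c c' u v f y z; rewrite /beta.
  rewrite (day_mk_natr (F := F)) comp1m [in RHS]day_mk_mkl day_mk_natr.
  by rewrite tensm_compr -!compA -massoc_nat -tensm_comp comp1m compm1.
split; first exact: day_rec_lin H1 H2 H3 H4.
by move=> b c g y z; apply: (@day_recE G H d _ beta).
Qed.

Let B2 (a d : C) x : linear (fun s => @wal a d x s).
Proof. exact (proj1 (@walP a d x)). Qed.

Let walE (a b c d : C) (x : F a) (g : Hom (b ⊗ c) d) y z :
  wal x (day_mk g y z)
  = day_mk ((id ⊠ g) ∘ al a b c) (day_mk id x y : (F ⊛ G) _) z.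
Proof. exact (proj2 (@walP a d x) b c g y z). Qed.

Let B1 (a d : C) s : linear (fun x => @wal a d x s).
Proof.
elim/day_ind: s => [|s t Es Et|b c g y z] r x x'.
- by rewrite !(linear_zero (B2 _)) scaler0 addr0.
- by rewrite !(linear_add (B2 _)) Es Et scalerDr addrACA.
- by rewrite !walE day_mk_linl day_mk_linl.
Qed.

Let B3 (a a' d d' : C) (u : Hom a a') (v : Hom d d') x s :
  wal (pmap F u x) (pmap (G ⊛ H) v s) = pmap ((F ⊛ G) ⊛ H) (u ⊠ v) (wal x s).
Proof.
elim/day_ind: s => [|s t Es Et|b c g y z].
- by rewrite pmap0 !(linear_zero (B2 _))
    pmap0.
- by rewrite pmapD !(linear_add (B2 _)) pmapD Es Et.
- rewrite pmap_day_mk !walE pmap_day_mk.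
  rewrite day_mk_natl comp1m [in LHS]day_mk_mkl; congr day_mk.
  rewrite -!compA massoc_nat !compA; congr (_ ∘ _).
  by rewrite tensm1 -!tensm_comp !comp1m !compm1.
Qed.

Definition day_assoc_inv : nat_trans (F ⊛ G ⊛ H) ((F ⊛ G) ⊛ H) :=
  day_lift B1 B2 B3.

Lemma day_assoc_invE (a b c d e : C) (f : Hom (a ⊗ d) e) (g : Hom (b ⊗ c) d) x y z :
  day_assoc_inv e (day_mk f x (day_mk g y z : (G ⊛ H) d))
  = day_mk (f ∘ (id ⊠ g) ∘ al a b c) (day_mk id x y : (F ⊛ G) _) z.
Proof. by rewrite day_liftE walE pmap_day_mk compA. Qed.

Definition day_assoc_iso : @iso (psh_cat C) ((F ⊛ G) ⊛ H) (F ⊛ G ⊛ H).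
Proof.
refine (@Iso (psh_cat C) _ _ day_assoc day_assoc_inv _ _).
- apply: day_ext3l => a b c d e f g x y z; rewrite !(nt_compE, nt_idE).
  rewrite day_assocE day_assoc_invE tensm1 compm1 -!compA ihomK compm1.
  by rewrite [in RHS]day_mk_mkl.
- apply: day_ext3r => a b c d e f g x y z; rewrite !(nt_compE, nt_idE).
  rewrite day_assoc_invE day_assocE tensm1 compm1 -!compA iinvK compm1.
  by rewrite [in RHS]day_mk_mkr.
Defined.

End Assoc.

Definition day_unit : psh C := yoneda (tunit C : C).

Lemma yoneda_mapE (x a b : C) (f : Hom a b) (g : Hom x a) :
  pmap (yoneda x) f g = f ∘ g.
Proof. by []. Qed.

Section Unit.
Variable F : psh C.

Let L1 (a b : C) y : linear (fun u : day_unit a =>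
  pmap F ((u ⊠ id) ∘ iinv (munitl C b)) y).
Proof. by move=> r f g; rewrite (tensm_linl (idm b : Hom b b)) comp_linl pmap_linl. Qed.
Let L2 (a b : C) (u : day_unit a) :
  linear (fun y : F b => pmap F ((u ⊠ id) ∘ iinv (munitl C b)) y).
Proof. exact: pmap_lin. Qed.
Let L3 (a a' b b' : C) (u : Hom a a') (v : Hom b b') (x : day_unit a) y :
  pmap F ((pmap day_unit u x ⊠ id) ∘ iinv (munitl C b')) (pmap F v y)
  = pmap F (u ⊠ v) (pmap F ((x ⊠ id) ∘ iinv (munitl C b)) y).
Proof.
rewrite -!pmap_compE; congr (pmap F _ y).
rewrite -compA iinv_unitl_nat !compA -!tensm_comp; congr (_ ∘ _).
by rewrite comp1m !compm1.
Qed.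

Definition day_unitl : nat_trans (day_unit ⊛ F) F := day_lift L1 L2 L3.

Lemma day_unitlE (a b c : C) (f : Hom (a ⊗ b) c) (u : day_unit a) y :
  day_unitl c (day_mk f u y) = pmap F (f ∘ (u ⊠ id) ∘ iinv (munitl C b)) y.
Proof. by rewrite day_liftE -compA [in RHS]pmap_compE. Qed.

Definition day_unitl_inv : nat_trans F (day_unit ⊛ F).
Proof.
refine (@NatTrans k C F (day_unit ⊛ F) (fun a y =>
  day_mk (ihom (munitl C a)) (idm (tunit C) : day_unit _) y) _ _).
- by move=> a; apply: day_mk_linr.
- move=> a b f y; rewrite pmap_day_mk day_mk_natr.
  by rewrite munitl_nat.
Defined.

Lemma day_unitl_invE (a : C) (y : F a) :
  day_unitl_inv a y = day_mk (ihom (munitl C a)) (idm (tunit C) : day_unit _) y.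
Proof. by []. Qed.

Definition day_unitl_iso : @iso (psh_cat C) (day_unit ⊛ F) F.
Proof.
refine (@Iso (psh_cat C) _ _ day_unitl day_unitl_inv _ _).
- apply: day_ext => a b c f u y; rewrite !(nt_compE, nt_idE).
  rewrite day_unitlE day_unitl_invE day_mk_natr munitl_nat -!compA ihomK compm1.
  by rewrite -day_mk_natl yoneda_mapE compm1.
- apply: nat_trans_eq => a y; rewrite !(nt_compE, nt_idE).
  by rewrite day_unitl_invE day_unitlE tensm1 compm1 iinvK pmap_id.
Defined.

Let R1 (a b : C) (u : day_unit b) : linear (fun y : F a =>
  pmap F ((id ⊠ u) ∘ iinv (munitr C a)) y).
Proof. exact: pmap_lin. Qed.
Let R2 (a b : C) (y : F a) :
  linear (fun u : day_unit b => pmap F ((id ⊠ u) ∘ iinv (munitr C a)) y).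
Proof. by move=> r f g; rewrite (tensm_linr (idm a : Hom a a)) comp_linl pmap_linl. Qed.
Let R3 (a a' b b' : C) (u : Hom a a') (v : Hom b b') y (x : day_unit b) :
  pmap F ((id ⊠ pmap day_unit v x) ∘ iinv (munitr C a')) (pmap F u y)
  = pmap F (u ⊠ v) (pmap F ((id ⊠ x) ∘ iinv (munitr C a)) y).
Proof.
rewrite -!pmap_compE; congr (pmap F _ y).
rewrite -compA iinv_unitr_nat !compA -!tensm_comp; congr (_ ∘ _).
by rewrite comp1m !compm1.
Qed.

Definition day_unitr : nat_trans (F ⊛ day_unit) F := day_lift R1 R2 R3.

Lemma day_unitrE (a b c : C) (f : Hom (a ⊗ b) c) y (u : day_unit b) :
  day_unitr c (day_mk f y u) = pmap F (f ∘ (id ⊠ u) ∘ iinv (munitr C a)) y.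
Proof. by rewrite day_liftE -compA [in RHS]pmap_compE. Qed.

Definition day_unitr_inv : nat_trans F (F ⊛ day_unit).
Proof.
refine (@NatTrans k C F (F ⊛ day_unit) (fun a y =>
  day_mk (ihom (munitr C a)) y (idm (tunit C) : day_unit _)) _ _).
- by move=> a; apply: day_mk_linl.
- move=> a b f y; rewrite pmap_day_mk day_mk_natl.
  by rewrite munitr_nat.
Defined.

Lemma day_unitr_invE (a : C) (y : F a) :
  day_unitr_inv a y = day_mk (ihom (munitr C a)) y (idm (tunit C) : day_unit _).
Proof. by []. Qed.

Definition day_unitr_iso : @iso (psh_cat C) (F ⊛ day_unit) F.
Proof.
refine (@Iso (psh_cat C) _ _ day_unitr day_unitr_inv _ _).
- apply: day_ext => a b c f y u; rewrite !(nt_compE, nt_idE).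
  rewrite day_unitrE day_unitr_invE day_mk_natl munitr_nat -!compA ihomK compm1.
  by rewrite -day_mk_natr yoneda_mapE compm1.
- apply: nat_trans_eq => a y; rewrite !(nt_compE, nt_idE).
  by rewrite day_unitr_invE day_unitrE tensm1 compm1 iinvK pmap_id.
Defined.

End Unit.

Lemma day_assoc_isoE (F G H : psh C) : ihom (day_assoc_iso F G H) = day_assoc F G H.
Proof. by []. Qed.
Lemma day_unitl_isoE (F : psh C) : ihom (day_unitl_iso F) = day_unitl F.
Proof. by []. Qed.
Lemma day_unitr_isoE (F : psh C) : ihom (day_unitr_iso F) = day_unitr F.
Proof. by []. Qed.

Definition day_simpE :=
  (nt_compE, nt_idE, day_assoc_isoE, day_unitl_isoE, day_unitr_isoE).

Definition day_monoidal : monoidal (psh_cat C).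
Proof.
refine (@Monoidal (psh_cat C) day day_hom day_unit day_assoc_iso day_unitl_iso
  day_unitr_iso _ _ _ _ _ _ _).
- by move=> F G; apply: day_ext => a b c f x y; rewrite day_homE.
- move=> F F' F'' G G' G'' s' s t' t; apply: day_ext => a b c f x y.
  rewrite !day_simpE.
  by rewrite !day_homE.
- move=> F F' G G' H H' r s t; apply: day_ext3l => a b c d e f g x y z.
  rewrite !day_simpE.
  by rewrite !(day_homE, day_assocE).
- move=> F F' s; apply: day_ext => a b c f x y.
  rewrite !day_simpE.
  by rewrite day_homE !day_unitlE nt_nat.
- move=> F F' s; apply: day_ext => a b c f x y.
  rewrite !day_simpE.
  by rewrite day_homE !day_unitrE nt_nat.
- move=> F G H K; apply: day_ext4l => a b c d p q e f g h x y z w.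
  rewrite !day_simpE.
  rewrite !(day_homE, day_assocE) tensm1 comp1m.
  rewrite [in LHS]day_mk_mkr; congr day_mk.
  rewrite comp1m -[_ ∘ _ ∘ (h ⊠ _)]compA -tensm1 iinv_assoc_nat.
  rewrite !tensm_compl -!compA; congr (_ ∘ _); congr (_ ∘ _); congr (_ ∘ _).
  by rewrite !compA pentagon_inv.
- move=> F G; apply: day_ext3l => a b c d e f g x u y.
  rewrite !day_simpE.
  rewrite !(day_homE, day_assocE, day_unitlE, day_unitrE) comp1m.
  rewrite day_mk_natr day_mk_natl; congr day_mk.
  rewrite tensm_compr !tensm_compl -!compA; congr (_ ∘ _); congr (_ ∘ _).
  by rewrite compA iinv_assoc_nat -compA triangle_inv.
Defined.

End Day.

(* Main.v *)
From HB Require Import structures.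
From mathcomp Require Import all_boot all_order all_algebra.
From mathcomp Require Import boolp.
Require Import Defs.

(** The three conditions are proved in a cycle.

    A right dual [Y] of [X] turns maps [X ⊗ c -> d] into maps [c -> Y ⊗ d] and
    back, which is the adjunction of (ii); this holds in every monoidal category
    ([right_dual_adjunction]).

    From (ii) to (iii), the adjunction at the unit object and the Yoneda lemma
    identify maps [X -> B] with elements of the vector space [(DX ⊛ B)(1)],
    naturally in [B]. Hence [f : X -> B] factors through [t : A -> B] as soon as
    its element lifts along [DX ⊛ t] ([adj_factor]). Epimorphisms of functors are
    surjective at every object ([epi_surj]) and [DX ⊛ -] preserves surjectivity
    ([day_hom_surj]), so [X] is projective. The element of [(DX ⊛ X)(1)] that
    corresponds to the identity of [X] is a finite sum of generators, hence comes
    from [DX ⊛ S] for some finite sum [S] of representables mapping to [X]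
    ([day_fg_support]): the identity of [X] factors through [S -> X], which is
    thus a split epimorphism.

    From (iii) to (i), [X] is a retract of a finite sum [S] of representables. If
    [y] is a left dual of [x] in [C], then the contravariance of the Yoneda
    embedding makes [C(y,-)] a right dual of [C(x,-)]. To pass to sums and
    retracts it pays to keep only one of the two zig-zag identities, the one on
    [X] ([dual_pairing]): it is inherited by a retract with the same [Y], and for
    sums only half of the verification remains. The second identity is restored
    at the end. Given the first one, the composite in the second one is an
    idempotent [e] of [Y] with [ev ∘ (X ⊗ e) = ev], and splitting [e] yields a
    right dual ([right_dual_split]). Idempotents split in the functor category
    because cokernels exist there: [e] splits through the cokernel of [1 - e]. *)

Set Implicit Arguments.
Unset Strict Implicit.
Unset Printing Implicit Defensive.
Import GRing.Theory.
Local Open Scope ring_scope.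
Local Open Scope quotient_scope.
Local Open Scope moncat_scope.

(** * Coherence of units and duality in a monoidal category *)

Section Coherence.
Variables (C : category) (M : monoidal C).
Local Notation "a ⊗ b" := (tens M a b) (at level 35, right associativity).
Local Notation "f ⊠ g" := (tensm M f g) (at level 35, right associativity).
Local Notation I := (tunit M).
Local Notation al a b c := (ihom (massoc M a b c)).
Local Notation ai a b c := (iinv (massoc M a b c)).
Local Notation lu a := (ihom (munitl M a)).
Local Notation li a := (iinv (munitl M a)).
Local Notation ru a := (ihom (munitr M a)).
Local Notation ri a := (iinv (munitr M a)).

Lemma iso_monic (a b c : C) (i : iso b c) (f g : hom a b) :
  ihom i ∘ f = ihom i ∘ g -> f = g.
Proof. by move=> E; rewrite -[f]comp1m -[g]comp1m -(ihomK i) -!compA E. Qed.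

Lemma iso_epic (a b c : C) (i : iso a b) (f g : hom b c) :
  f ∘ ihom i = g ∘ ihom i -> f = g.
Proof. by move=> E; rewrite -[f]compm1 -[g]compm1 -(iinvK i) !compA E. Qed.

Lemma tens_unitl_inj (a b : C) (f g : hom a b) :
  idm I ⊠ f = idm I ⊠ g -> f = g.
Proof. by move=> E; apply: (iso_epic (i := munitl M a)); rewrite -!munitl_nat E. Qed.

Lemma tens_unitr_inj (a b : C) (f g : hom a b) :
  f ⊠ idm I = g ⊠ idm I -> f = g.
Proof. by move=> E; apply: (iso_epic (i := munitr M a)); rewrite -!munitr_nat E. Qed.

(** Kelly's consequences of the pentagon and triangle axioms, needed because the
    zig-zag composites insert and delete unit objects. Since tensoring with the
    unit is faithful, the identity may be tensored with the unit on the left;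
    there it is a face of the pentagon on [I, I, a, b] with both adjacent
    triangles removed. *)
Lemma unitl_tens (a b : C) : lu (a ⊗ b) ∘ al I a b = lu a ⊠ idm b.
Proof.
apply: tens_unitl_inj; rewrite tensm_compr.
apply: (iso_epic (i := massoc M I (I ⊗ a) b)).
have E : (idm I ⊠ lu (a ⊗ b)) ∘ (idm I ⊠ al I a b) ∘ al I (I ⊗ a) b
    ∘ (al I I a ⊠ idm b)
  = (idm I ⊠ lu a ⊠ idm b) ∘ al I (I ⊗ a) b ∘ (al I I a ⊠ idm b).
  rewrite -!compA [in LHS](compA (idm I ⊠ al I a b)) mpentagon compA mtriangle.
  rewrite -tensm1 -massoc_nat -mtriangle tensm_compl compA massoc_nat.
  by rewrite !compA.
rewrite -[LHS]compm1 -[RHS]compm1 -tensm1 -(iinvK (massoc M I I a)) tensm_compl.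
by rewrite [LHS]compA [RHS]compA E.
Qed.

(** The mirror image: tensored with the unit on the right, it is a face of the
    pentagon on [a, b, I, I]. *)
Lemma unitr_tens (a b : C) : (idm a ⊠ ru b) ∘ al a b I = ru (a ⊗ b).
Proof.
apply: tens_unitr_inj; rewrite tensm_compl.
apply: (iso_monic (i := massoc M a b I)).
rewrite compA massoc_nat -(mtriangle M b) tensm_compr.
rewrite -[RHS]/(al a b I ∘ (ru (a ⊗ b) ⊠ idm I)) -(mtriangle M (a ⊗ b)).
rewrite -tensm1 [RHS]compA massoc_nat -!compA -[in RHS]mpentagon.
by rewrite !compA.
Qed.

Lemma unitl_unitr : lu I = ru I.
Proof.
apply: tens_unitr_inj; rewrite -unitl_tens -mtriangle; congr (_ ∘ _).
by apply: (iso_monic (i := munitl M I)); rewrite munitl_nat.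
Qed.

Lemma pentagon_r (a b c d : C) :
  ai a b (c ⊗ d) ∘ (idm a ⊠ al b c d)
  = al (a ⊗ b) c d ∘ (ai a b c ⊠ idm d) ∘ ai a (b ⊗ c) d.
Proof.
apply: (iso_monic (i := massoc M a b (c ⊗ d))).
rewrite !compA iinvK comp1m -mpentagon -!compA (compA (al a b c ⊠ _)).
by rewrite -tensm_compl iinvK tensm1 comp1m iinvK compm1.
Qed.

Lemma pentagon_l (a b c d : C) :
  (idm a ⊠ ai b c d) ∘ al a b (c ⊗ d)
  = al a (b ⊗ c) d ∘ (al a b c ⊠ idm d) ∘ ai (a ⊗ b) c d.
Proof.
apply: (iso_epic (i := massoc M (a ⊗ b) c d)).
rewrite -!compA -mpentagon ihomK compm1 !compA -tensm_compr ihomK tensm1.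
by rewrite comp1m.
Qed.

Lemma iinv_unitl_tens (a b : C) : ai I a b ∘ li (a ⊗ b) = li a ⊠ idm b.
Proof.
apply: (inv_unique (f := lu a ⊠ idm b)).
- by rewrite -unitl_tens compA -[_ ∘ li _ ∘ _]compA ihomK compm1 ihomK.
- by rewrite -tensm_compl iinvK tensm1.
Qed.

Lemma iinv_unitr_tens (a b : C) : ai a b I ∘ (idm a ⊠ ri b) = ri (a ⊗ b).
Proof.
apply: (inv_unique (f := ru (a ⊗ b))); last exact: iinvK.
rewrite -unitr_tens compA -[_ ∘ (_ ⊠ ri b) ∘ _]compA -tensm_compr ihomK tensm1.
by rewrite compm1 ihomK.
Qed.

(** The composites of the two zig-zag identities, for [ev] and [coev] that need
    not form a duality. The two outer objects may differ, which lets [ev] and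
    [coev] be varied independently of each other. *)
Definition zigzag (x x' y : C) (ev : hom (x ⊗ y) I) (coev : hom I (y ⊗ x')) :
    hom x x' :=
  lu x' ∘ (ev ⊠ idm x') ∘ ai x y x' ∘ (idm x ⊠ coev) ∘ ri x.

Definition zagzig (x y y' : C) (ev : hom (x ⊗ y) I) (coev : hom I (y' ⊗ x)) :
    hom y y' :=
  ru y' ∘ (idm y' ⊠ ev) ∘ al y' x y ∘ (coev ⊠ idm y) ∘ li y.

(** Maps on the outer objects pass through to the outside, while on the middle
    object only the composite [u ∘ r] counts, on whichever side it is put. *)
Lemma zigzag_nat (x x' y y' z z' w : C) (ev : hom (x ⊗ y) I)
    (coev : hom I (y' ⊗ x')) (p : hom z x) (u : hom w y) (r : hom y' w)
    (q : hom x' z') :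
  zigzag (ev ∘ (p ⊠ u)) ((r ⊠ q) ∘ coev)
  = q ∘ zigzag ev (((u ∘ r) ⊠ idm x') ∘ coev) ∘ p.
Proof.
rewrite /zigzag -!compA [in RHS]iinv_unitr_nat.
rewrite [in RHS]compA -munitl_nat -!compA; congr (_ ∘ _).
rewrite !compA; congr (_ ∘ _); rewrite -tensm_swap tensm_compl.
rewrite -(compA _ _ (ai _ _ _)) -iinv_assoc_nat -(compA _ _ (ai _ _ _)) -tensm1.
rewrite -iinv_assoc_nat -!compA -!tensm_comp comp1m compm1; congr (_ ∘ (_ ∘ _)).
by rewrite comp1m compm1 !compA -!tensm_comp !comp1m compm1.
Qed.

Lemma zagzig_nat (x y y' z z' : C) (ev : hom (x ⊗ y) I)
    (coev : hom I (y' ⊗ x)) (p : hom z y) (r : hom y' z') :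
  zagzig (ev ∘ (idm x ⊠ p)) ((r ⊠ idm x) ∘ coev) = r ∘ zagzig ev coev ∘ p.
Proof.
rewrite /zagzig -!compA [in RHS]iinv_unitl_nat.
rewrite [in RHS]compA -munitr_nat -!compA; congr (_ ∘ _).
rewrite !compA; congr (_ ∘ _); rewrite -tensm_split tensm_compl.
rewrite -!compA (compA (al _ _ _)) massoc_nat.
rewrite tensm_swap (compA (al y' x y)) -[idm (y' ⊗ x)]tensm1 massoc_nat !compA.
by rewrite -!tensm_comp tensm1 !comp1m !compm1.
Qed.

Section Transpose.
Variables (x y : C) (ev : hom (x ⊗ y) I) (coev : hom I (y ⊗ x)).

(** The two transposes. That one of them is a left inverse of the other uses
    only the zig-zag identity on [x], and the opposite composite only the one on
    [y]: after naturality, what remains of the composite is [zigzag] or [zagzig]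
    tensored with the passive object. *)
Definition curry (c d : C) (f : hom (x ⊗ c) d) : hom c (y ⊗ d) :=
  (idm y ⊠ f) ∘ al y x c ∘ (coev ⊠ idm c) ∘ li c.

Definition uncurry (c d : C) (g : hom c (y ⊗ d)) : hom (x ⊗ c) d :=
  lu d ∘ (ev ⊠ idm d) ∘ ai x y d ∘ (idm x ⊠ g).

Lemma curry_nat (c c' d d' : C) (u : hom c' c) (v : hom d d') (f : hom (x ⊗ c) d) :
  curry (v ∘ f ∘ (idm x ⊠ u)) = (idm y ⊠ v) ∘ curry f ∘ u.
Proof.
rewrite /curry !tensm_compr -!compA; do 2 congr (_ ∘ _).
rewrite iinv_unitl_nat !compA; congr (_ ∘ _).
by rewrite -massoc_nat -!compA -tensm_split tensm1 -tensm_swap -tensm_split.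
Qed.

Lemma zigzag_tensr (c : C) :
  lu (x ⊗ c) ∘ (ev ⊠ idm (x ⊗ c)) ∘ ai x y (x ⊗ c) ∘ (idm x ⊠ al y x c)
    ∘ (idm x ⊠ coev ⊠ idm c) ∘ (idm x ⊠ li c)
  = zigzag ev coev ⊠ idm c.
Proof.
rewrite /zigzag !tensm_compl -unitl_tens -triangle_inv -!compA.
congr (_ ∘ _); rewrite [in RHS](compA (al _ _ _)) massoc_nat -!compA tensm1.
congr (_ ∘ _); rewrite [in LHS](compA (ai _ _ _)) pentagon_r -!compA.
congr (_ ∘ (_ ∘ _)).
by rewrite compA iinv_assoc_nat -!compA.
Qed.

Lemma zagzig_tensr (d : C) :
  (idm y ⊠ lu d) ∘ (idm y ⊠ ev ⊠ idm d) ∘ (idm y ⊠ ai x y d)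
    ∘ al y x (y ⊗ d) ∘ (coev ⊠ idm (y ⊗ d)) ∘ li (y ⊗ d)
  = zagzig ev coev ⊠ idm d.
Proof.
rewrite /zagzig !tensm_compl -mtriangle -iinv_unitl_tens -!compA.
congr (_ ∘ _); rewrite [in RHS](compA (al _ _ _)) massoc_nat -!compA.
congr (_ ∘ _); rewrite [in LHS](compA (_ ⊠ ai _ _ _)) pentagon_l -!compA.
congr (_ ∘ (_ ∘ _)).
by rewrite compA -tensm1 iinv_assoc_nat -!compA.
Qed.

Lemma curryK (c d : C) :
  zigzag ev coev = idm x -> cancel (@curry c d) (@uncurry c d).
Proof.
move=> zz f; rewrite /uncurry /curry !tensm_compr !compA.
rewrite -(compA _ (ai x y d)) iinv_assoc_nat tensm1 !compA -(compA _ (ev ⊠ _)).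
rewrite tensm_swap !compA munitl_nat.
by rewrite -[RHS]compm1 -[idm _ in RHS]tensm1 -[idm x in RHS]zz -zigzag_tensr !compA.
Qed.

Lemma uncurryK (c d : C) :
  zagzig ev coev = idm y -> cancel (@uncurry c d) (@curry c d).
Proof.
move=> zz g; rewrite /uncurry /curry !tensm_compr.
rewrite -(compA _ _ (al y x c)) -massoc_nat tensm1 -!compA.
rewrite (compA (_ ⊠ g)) -tensm_swap -!compA -iinv_unitl_nat.
rewrite -[RHS]comp1m -[idm _ in RHS]tensm1 -[idm y in RHS]zz.
by rewrite -zagzig_tensr !compA.
Qed.

(** Up to unit isomorphisms, [zagzig ev coev] is the transpose of [ev] and the
    right-hand side [ev] is the inverse transpose of the identity, so this is
    [curryK] applied to [ev]. *)
Lemma ev_zagzig : zigzag ev coev = idm x -> ev ∘ (idm x ⊠ zagzig ev coev) = ev.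
Proof.
move=> zz; have ev_ri : uncurry (ri y) = ev.
  rewrite /uncurry -compA iinv_unitr_tens -compA -iinv_unitr_nat unitl_unitr.
  by rewrite compA iinvK comp1m.
have E : curry ev = ri y ∘ zagzig ev coev.
  by rewrite /curry /zagzig !compA ihomK comp1m.
by rewrite -[RHS](curryK zz) E /uncurry tensm_compr compA -/(uncurry _) ev_ri.
Qed.

End Transpose.

(** Half a duality suffices when idempotents split: cutting [y] down to the image
    of [zagzig ev coev] does not affect the zig-zag identity on [x], by
    [ev_zagzig], and makes the other one true. *)
Lemma right_dual_split (x y z : C) (ev : hom (x ⊗ y) I) (coev : hom I (y ⊗ x))
    (r : hom y z) (i : hom z y) :
  zigzag ev coev = idm x -> r ∘ i = idm z -> i ∘ r = zagzig ev coev ->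
  is_right_dual M x z.
Proof.
move=> zz ri ir.
have zz' : zigzag (ev ∘ (idm x ⊠ i)) ((r ⊠ idm x) ∘ coev) = idm x.
  rewrite zigzag_nat comp1m compm1 ir -[RHS]zz.
  have := zigzag_nat ev coev (idm x) (zagzig ev coev) (idm y) (idm x).
  by rewrite ev_zagzig // tensm1 !comp1m !compm1.
have zz'' : zagzig (ev ∘ (idm x ⊠ i)) ((r ⊠ idm x) ∘ coev) = idm z.
  by rewrite zagzig_nat -ir compA ri comp1m.
split; exact: (RightDual zz' zz'').
Qed.

Lemma zagzig_idem (x y : C) (ev : hom (x ⊗ y) I) (coev : hom I (y ⊗ x)) :
  zigzag ev coev = idm x ->
  zagzig ev coev ∘ zagzig ev coev = zagzig ev coev.
Proof.
move=> zz; rewrite -{1}[zagzig _ _]comp1m -zagzig_nat ev_zagzig //.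
by rewrite tensm1 comp1m.
Qed.

Lemma right_dual_adjunction (x y : C) : is_right_dual M x y ->
  right_adjoint (tens_functor M y) (tens_functor M x).
Proof.
case=> [[ev coev zz zz']]; split.
exact: (@Adjunction C C (tens_functor M x) (tens_functor M y)
  (@curry x y coev) (@uncurry x y ev)
  (fun c d => curryK zz) (fun c d => uncurryK zz') (@curry_nat x y coev)).
Qed.

(** Half of a duality: a retract inherits it with the same [y], while a full
    duality would force [y] to shrink along with [x]. *)
Definition dual_pairing (x y : C) :=
  exists (ev : hom (x ⊗ y) I) (coev : hom I (y ⊗ x)), zigzag ev coev = idm x.

Lemma dual_pairing_retract (x x' y : C) (p : hom x' x) (i : hom x x') :
  p ∘ i = idm x -> dual_pairing x' y -> dual_pairing x y.
Proof.
move=> pi [ev [coev zz]].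
exists (ev ∘ (i ⊠ idm y)), ((idm y ⊠ p) ∘ coev).
by rewrite zigzag_nat comp1m tensm1 comp1m zz compm1.
Qed.

End Coherence.

(** * Cokernels of linear maps and of natural transformations *)

Lemma linear_sub (k : fieldType) (U V : lmodType k) (f : U -> V) x y :
  linear f -> f (x - y) = f x - f y.
Proof. by move=> lf; rewrite addrC -scaleN1r lf scaleN1r addrC. Qed.

Section Cokernel.
Variables (k : fieldType) (U V : lmodType k) (f : U -> V) (lf : linear f).

(** The linearity proof is an argument so that the closure properties below can
    be attached to the predicate. *)
Definition im_pred of linear f : {pred V} := fun y => `[< exists x, f x = y >].

Lemma im_zmod_closed : zmod_closed (im_pred lf).
Proof.
split; first by apply/asboolP; exists 0; exact: linear_zero.
move=> y y' /asboolP[x <-] /asboolP[x' <-]; apply/asboolP; exists (-1 *: x' + x).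
by rewrite lf scaleN1r addrC.
Qed.

HB.instance Definition _ := GRing.isZmodClosed.Build V (im_pred lf) im_zmod_closed.

Definition coker : Type := Quotient.quot (im_pred lf).
HB.instance Definition _ := GRing.Zmodule.on coker.

Definition coker_pi (y : V) : coker := \pi_(Quotient.quot (im_pred lf)) y.

Lemma coker_reprK (x : coker) : coker_pi (repr x) = x.
Proof. exact: reprK. Qed.

Lemma coker_piP (y y' : V) :
  coker_pi y = coker_pi y' <-> exists x, f x = y - y'.
Proof.
split; first by move/eqquotP/asboolP.
by move=> E; apply/eqquotP/asboolP.
Qed.

Definition coker_scale (a : k) (x : coker) : coker := coker_pi (a *: repr x).

Lemma coker_piZ (a : k) (y : V) : coker_pi (a *: y) = coker_scale a (coker_pi y).
Proof.
have /coker_piP[x E] := esym (coker_reprK (coker_pi y)).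
by apply/coker_piP; exists (a *: x); rewrite linear_scale // E scalerBr.
Qed.

Lemma coker_piD (y y' : V) : coker_pi (y + y') = coker_pi y + coker_pi y'.
Proof. exact: raddfD. Qed.

Lemma coker_scaleA a b x : coker_scale a (coker_scale b x) = coker_scale (a * b) x.
Proof. by rewrite -(coker_reprK x) -!coker_piZ scalerA. Qed.
Lemma coker_scale1 : left_id 1 coker_scale.
Proof. by move=> x; rewrite /coker_scale scale1r coker_reprK. Qed.
Lemma coker_scaleDr : right_distributive coker_scale +%R.
Proof.
move=> a x y; rewrite -(coker_reprK x) -(coker_reprK y) -coker_piD -!coker_piZ.
by rewrite scalerDr coker_piD.
Qed.
Lemma coker_scaleDl x : {morph coker_scale^~ x : a b / a + b}.
Proof. by move=> a b; rewrite /coker_scale scalerDl coker_piD. Qed.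

HB.instance Definition _ := GRing.Zmodule_isLmodule.Build k coker
  coker_scaleA coker_scale1 coker_scaleDr coker_scaleDl.

Lemma coker_pi_lin : linear coker_pi.
Proof. by move=> a x y; rewrite coker_piD coker_piZ. Qed.

End Cokernel.

Section PshCokernel.
Variables (k : fieldType) (C : lincat k) (A B : psh C) (t : nat_trans A B).

Local Notation pi c := (@coker_pi _ _ _ _ (@nt_lin _ _ _ _ t c)).

Definition psh_coker_map (c d : C) (h : lhom c d)
    (x : coker (@nt_lin _ _ _ _ t c)) : coker (@nt_lin _ _ _ _ t d) :=
  pi d (pmap B h (repr x)).

Lemma psh_coker_mapE (c d : C) (h : lhom c d) (y : B c) :
  psh_coker_map h (pi c y) = pi d (pmap B h y).
Proof.
have /coker_piP[x E] := coker_reprK (pi c y).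
apply/coker_piP; exists (pmap A h x).
rewrite nt_nat E linear_sub //; exact: pmap_lin.
Qed.

Definition psh_coker : psh C.
Proof.
refine (@Psh k C (fun c => coker (@nt_lin _ _ _ _ t c)) psh_coker_map _ _ _ _).
- move=> c d h a x y; rewrite -(coker_reprK x) -(coker_reprK y).
  by rewrite -coker_pi_lin !psh_coker_mapE pmap_lin coker_pi_lin.
- by move=> c d x a f g; rewrite /psh_coker_map pmap_linl coker_pi_lin.
- by move=> c x; rewrite /psh_coker_map pmap1 coker_reprK.
- move=> c d e f g x; rewrite -(coker_reprK x).
  by rewrite !psh_coker_mapE pmap_comp.
Defined.

Definition psh_coker_pi : nat_trans B psh_coker.
Proof.
refine (@NatTrans k C B psh_coker (fun c => pi c) _ _).
- by move=> c; apply: coker_pi_lin.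
- by move=> c d h y; rewrite [RHS]psh_coker_mapE.
Defined.

Lemma psh_coker_piP (c : C) (y y' : B c) :
  psh_coker_pi c y = psh_coker_pi c y' <-> exists x, t c x = y - y'.
Proof. exact: coker_piP. Qed.

Lemma psh_coker_pi_repr (c : C) (x : psh_coker c) :
  psh_coker_pi c (repr (x : coker _)) = x.
Proof. exact: coker_reprK. Qed.

Variables (D : psh C) (s : nat_trans B D).
Hypothesis st0 : forall c x, s c (t c x) = 0.

Definition psh_coker_lift_fun (c : C) (x : psh_coker c) : D c :=
  s c (repr (x : coker _)).

Lemma psh_coker_lift_pi (c : C) (y : B c) :
  psh_coker_lift_fun (psh_coker_pi c y) = s c y.
Proof.
rewrite /psh_coker_lift_fun.
have /psh_coker_piP[x E] := psh_coker_pi_repr (psh_coker_pi c y).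
apply/eqP; rewrite -subr_eq0 -linear_sub -?E ?st0 //; exact: nt_lin.
Qed.

Definition psh_coker_lift : nat_trans psh_coker D.
Proof.
refine (@NatTrans k C psh_coker D psh_coker_lift_fun _ _).
- move=> c a x y; rewrite -(psh_coker_pi_repr x) -(psh_coker_pi_repr y).
  by rewrite -(@nt_lin _ _ _ _ psh_coker_pi) !psh_coker_lift_pi nt_lin.
- move=> c d h x; rewrite -(psh_coker_pi_repr x).
  by rewrite -nt_nat !psh_coker_lift_pi nt_nat.
Defined.

End PshCokernel.

(** * Additive structure of the functor category *)

Section Additive.
Variables (k : fieldType) (C : lincat k).

Definition nt_zero (F G : psh C) : nat_trans F G.
Proof.
refine (@NatTrans k C F G (fun c x => 0) _ _).
- by move=> c a x y; rewrite scaler0 addr0.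
- by move=> c d h x; rewrite (linear_zero (pmap_lin _)).
Defined.

Definition nt_add (F G : psh C) (s t : nat_trans F G) : nat_trans F G.
Proof.
refine (@NatTrans k C F G (fun c x => s c x + t c x) _ _).
- by move=> c a x y; rewrite !nt_lin scalerDr addrACA.
- by move=> c d h x; rewrite !nt_nat (linear_add (pmap_lin _)).
Defined.

Lemma nt_addE (F G : psh C) (s t : nat_trans F G) c x :
  nt_add s t c x = s c x + t c x.
Proof. by []. Qed.

Lemma nt_zeroE (F G : psh C) c x : nt_zero F G c x = 0.
Proof. by []. Qed.

Lemma nt_comp_addl (F G H : psh_cat C) (s s' : nat_trans G H) (t : hom F G) :
  (nt_add s s' : hom G H) ∘ t = nt_add ((s : hom G H) ∘ t) ((s' : hom G H) ∘ t).
Proof. exact: nat_trans_eq. Qed.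

Lemma nt_comp_addr (F G H : psh_cat C) (s : hom G H) (t t' : nat_trans F G) :
  s ∘ (nt_add t t' : hom F G) = nt_add (s ∘ (t : hom F G)) (s ∘ (t' : hom F G)).
Proof.
apply: nat_trans_eq => c x.
exact: (linear_add (@nt_lin _ _ _ _ (s : nat_trans G H) c)).
Qed.

Lemma nt_comp_zerol (F G H : psh_cat C) (t : hom F G) :
  (nt_zero G H : hom G H) ∘ t = nt_zero F H.
Proof. exact: nat_trans_eq. Qed.

Lemma nt_comp_zeror (F G H : psh_cat C) (s : hom G H) :
  s ∘ (nt_zero F G : hom F G) = nt_zero F H.
Proof.
apply: nat_trans_eq => c x.
exact: (linear_zero (@nt_lin _ _ _ _ (s : nat_trans G H) c)).
Qed.

(** The projection to the cokernel of [t] and the zero map agree after [t], so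
    the cokernel of an epimorphism vanishes. *)
Lemma epi_surj (A B : psh_cat C) (t : hom A B) :
  epi t -> forall (c : C) (y : (B : psh C) c),
    exists x, (t : nat_trans A B) c x = y.
Proof.
move=> et c y.
have E : psh_coker_pi t = nt_zero B (psh_coker t).
  apply: (et (psh_coker t)); apply: nat_trans_eq => d x.
  rewrite -[RHS](linear_zero (@nt_lin _ _ _ _ (psh_coker_pi t) d)).
  by apply/psh_coker_piP; exists x; rewrite subr0.
have: psh_coker_pi t c y = psh_coker_pi t c 0.
  by rewrite (linear_zero (@nt_lin _ _ _ _ (psh_coker_pi t) c)) E.
by case/psh_coker_piP => x; rewrite subr0; exists x.
Qed.

(** The image is taken to be the cokernel of [1 - e], which works because [e] kills the image of [1 - e] and agrees
    with the identity modulo that image. *)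
Lemma idempotent_split (F : psh_cat C) (e : hom F F) : e ∘ e = e ->
  exists (G : psh_cat C) (r : hom F G) (i : hom G F), r ∘ i = idm G /\ i ∘ r = e.
Proof.
move=> ee; pose e' := e : nat_trans F F.
have ee' c x : e' c (e' c x) = e' c x by rewrite -[in RHS](_ : e ∘ e = e').
have e1_lin c : linear (fun x => x - e' c x).
  by move=> a x y; rewrite nt_lin opprD scalerBr addrACA.
have e1_nat c d (h : lhom c d) x :
    pmap (F : psh C) h x - e' d (pmap F h x) = pmap F h (x - e' c x).
  by rewrite nt_nat linear_sub //; apply: pmap_lin.
pose e1 : nat_trans F F := NatTrans e1_lin e1_nat.
have e0 c x : e' c (e1 c x) = 0.
  by rewrite linear_sub ?ee' ?subrr //; apply: nt_lin.
exists (psh_coker e1), (psh_coker_pi e1), (psh_coker_lift e0); split.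
- apply: nat_trans_eq => c x; rewrite -(psh_coker_pi_repr x).
  set y := repr _.
  have -> : ((psh_coker_pi e1 : hom F _) ∘ psh_coker_lift e0) c
      (psh_coker_pi e1 c y) = psh_coker_pi e1 c (e' c y).
    by congr (psh_coker_pi e1 c _); exact: psh_coker_lift_pi.
  by apply/esym/psh_coker_piP; exists y.
- by apply: nat_trans_eq => c x; exact: psh_coker_lift_pi.
Qed.

Definition yoneda_elt (F : psh C) (x : C) (z : F x) : nat_trans (yoneda x) F.
Proof.
refine (@NatTrans k C (yoneda x) F (fun c h => pmap F h z) _ _).
- by move=> c a h h'; rewrite pmap_linl.
- by move=> c d h h'; rewrite -pmap_comp.
Defined.

Lemma yoneda_ext (F : psh C) (x : C) (s t : nat_trans (yoneda x) F) :
  s x (lidm x) = t x (lidm x) -> s = t.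
Proof.
move=> E; apply: nat_trans_eq => c h.
by rewrite -(lcompm1 h) -[lcomp _ _]/(pmap (yoneda x) h (lidm x)) !nt_nat E.
Qed.

Definition nt_inl (F G : psh C) : nat_trans F (psh_sum F G).
Proof.
refine (@NatTrans k C F (psh_sum F G) (fun c x => (x, 0)) _ _).
- by move=> c a x y; congr pair; rewrite /= scaler0 addr0.
- by move=> c d h x; congr pair; rewrite /= (linear_zero (pmap_lin _)).
Defined.

Definition nt_inr (F G : psh C) : nat_trans G (psh_sum F G).
Proof.
refine (@NatTrans k C G (psh_sum F G) (fun c x => (0, x)) _ _).
- by move=> c a x y; congr pair; rewrite /= scaler0 addr0.
- by move=> c d h x; congr pair; rewrite /= (linear_zero (pmap_lin _)).
Defined.

Definition nt_fst (F G : psh C) : nat_trans (psh_sum F G) F.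
Proof. by refine (@NatTrans k C (psh_sum F G) F (fun c x => x.1) _ _). Defined.

Definition nt_snd (F G : psh C) : nat_trans (psh_sum F G) G.
Proof. by refine (@NatTrans k C (psh_sum F G) G (fun c x => x.2) _ _). Defined.

Definition nt_case (F G H : psh C) (s : nat_trans F H) (t : nat_trans G H) :
  nat_trans (psh_sum F G) H :=
  nt_add (nt_comp s (nt_fst F G)) (nt_comp t (nt_snd F G)).

End Additive.

(** * Duality for Day convolution *)

Section DayDual.
Variables (k : fieldType) (C : lmoncat k).
Local Notation D := (day_monoidal C).
Local Notation "F ⊛ G" := (day F G) (at level 35, right associativity).
Local Notation "a ⊗ b" := (tens C a b) (at level 35, right associativity).
Local Notation "f ⊠ g" := (tensm C f g) (at level 35, right associativity).
Local Notation Hom := (@lhom k C).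
Local Notation Unit := (tunit D).

Lemma day_hom_addl (F F' G G' : psh C)
    (s s' : nat_trans F F') (t : nat_trans G G') :
  day_hom (nt_add s s') t = nt_add (day_hom s t) (day_hom s' t).
Proof.
by apply: day_ext => a b c f x y; rewrite nt_addE !day_homE day_mkDl.
Qed.

Lemma day_hom_addr (F F' G G' : psh C)
    (s : nat_trans F F') (t t' : nat_trans G G') :
  day_hom s (nt_add t t') = nt_add (day_hom s t) (day_hom s t').
Proof.
by apply: day_ext => a b c f x y; rewrite nt_addE !day_homE day_mkDr.
Qed.

Lemma day_hom_zerol (F F' G G' : psh C) (t : nat_trans G G') :
  day_hom (nt_zero F F') t = nt_zero (F ⊛ G) (F' ⊛ G').
Proof.
by apply: day_ext => a b c f x y; rewrite nt_zeroE day_homE day_mk0l.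
Qed.

Lemma day_hom_zeror (F F' G G' : psh C) (s : nat_trans F F') :
  day_hom s (nt_zero G G') = nt_zero (F ⊛ G) (F' ⊛ G').
Proof.
by apply: day_ext => a b c f x y; rewrite nt_zeroE day_homE day_mk0r.
Qed.

Section ZigzagAdd.
Variables X X' Y : psh_cat C.

Lemma zigzag_addl (ev ev' : nat_trans (X ⊛ Y) (day_unit C))
    (coev : hom Unit (tens D Y X')) :
  @zigzag _ D X X' Y (nt_add ev ev') coev
  = nt_add (@zigzag _ D X X' Y ev coev) (@zigzag _ D X X' Y ev' coev).
Proof.
rewrite /zigzag [tensm D (nt_add _ _) _]day_hom_addl.
by rewrite nt_comp_addr !nt_comp_addl.
Qed.

Lemma zigzag_addr (ev : hom (tens D X Y) Unit)
    (coev coev' : nat_trans (day_unit C) (Y ⊛ X')) :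
  @zigzag _ D X X' Y ev (nt_add coev coev')
  = nt_add (@zigzag _ D X X' Y ev coev) (@zigzag _ D X X' Y ev coev').
Proof.
rewrite /zigzag [tensm D _ (nt_add _ _)]day_hom_addr.
by rewrite nt_comp_addr !nt_comp_addl.
Qed.

Lemma zigzag_zeror (ev : hom (tens D X Y) Unit) :
  @zigzag _ D X X' Y ev (nt_zero (day_unit C) (Y ⊛ X')) = nt_zero X X'.
Proof.
rewrite /zigzag [tensm D _ (nt_zero _ _)]day_hom_zeror.
by rewrite nt_comp_zeror !nt_comp_zerol.
Qed.

End ZigzagAdd.

Lemma dual_pairing_zero :
  exists Y : psh_cat C, dual_pairing D (psh_zero C : psh_cat C) Y.
Proof.
exists (psh_zero C), (nt_zero _ _), (nt_zero _ _).
by apply: nat_trans_eq => c x; rewrite [LHS]thinmx0 [RHS]thinmx0.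
Qed.

(** The zig-zag composite is bilinear, so for the sums of the evaluations and of
    the coevaluations it has four terms. The two mixed ones vanish because they
    factor through a zero map on the middle object, and the other two are the
    projections of the sum onto its summands. *)
Lemma dual_pairing_sum (X X' Y Y' : psh_cat C) :
  dual_pairing D X Y -> dual_pairing D X' Y' ->
  dual_pairing D (psh_sum X X' : psh_cat C) (psh_sum Y Y' : psh_cat C).
Proof.
move=> [ev [coev zz]] [ev' [coev' zz']].
pose S : psh_cat C := psh_sum X X'; pose T : psh_cat C := psh_sum Y Y'.
pose pX : hom S X := nt_fst X X'; pose pX' : hom S X' := nt_snd X X'.
pose pY : hom T Y := nt_fst Y Y'; pose pY' : hom T Y' := nt_snd Y Y'.
pose iX : hom X S := nt_inl X X'; pose iX' : hom X' S := nt_inr X X'.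
pose iY : hom Y T := nt_inl Y Y'; pose iY' : hom Y' T := nt_inr Y Y'.
exists (nt_add (ev ∘ tensm D pX pY) (ev' ∘ tensm D pX' pY')).
exists (nt_add (tensm D iY iX ∘ coev) (tensm D iY' iX' ∘ coev')).
rewrite zigzag_addl !zigzag_addr !zigzag_nat.
have -> : pY ∘ iY = idm Y by exact: nat_trans_eq.
have -> : pY' ∘ iY' = idm Y' by exact: nat_trans_eq.
have -> : pY ∘ iY' = nt_zero Y' Y by exact: nat_trans_eq.
have -> : pY' ∘ iY = nt_zero Y Y' by exact: nat_trans_eq.
rewrite [tensm D (nt_zero Y' Y) _]day_hom_zerol.
rewrite [tensm D (nt_zero Y Y') _]day_hom_zerol.
rewrite !tensm1 !comp1m zz zz' !nt_comp_zerol !zigzag_zeror !nt_comp_zeror.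
rewrite !nt_comp_zerol !compm1.
apply: nat_trans_eq => c [z z'].
by congr pair; rewrite /= ?addr0 ?add0r.
Qed.

(** The coevaluation of [C] gives the evaluation and vice versa. By the Yoneda
    lemma the zig-zag composite on [C(x,-)] is determined by its value on the
    identity of [x], and that value is the composite [x -> x] in the second
    zig-zag identity of the duality in [C]. *)
Lemma dual_pairing_yoneda (x y : C) : is_left_dual C x y ->
  dual_pairing D (yoneda x : psh_cat C) (yoneda y : psh_cat C).
Proof.
move=> [[ev coev _ zagzig]].
pose pairing a b (u : yoneda x a) (v : yoneda y b) : day_unit C (a ⊗ b) :=
  (u ⊠ v) ∘ coev.
have pairing_linl a b v : linear (fun u => @pairing a b u v).
  by move=> r u u'; rewrite /pairing (tensm_linl v) comp_linl.
have pairing_linr a b u : linear (fun v => @pairing a b u v).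
  by move=> r v v'; rewrite /pairing (tensm_linr u) comp_linl.
have pairing_nat a a' b b' (f : Hom a a') (g : Hom b b') u v :
    pairing a' b' (pmap (yoneda x) f u) (pmap (yoneda y) g v)
    = pmap (day_unit C) (f ⊠ g) (pairing a b u v).
  by rewrite /pairing !yoneda_mapE tensm_comp compA.
pose dev := day_lift pairing_linl pairing_linr pairing_nat.
pose dcoev := @yoneda_elt k C (yoneda y ⊛ yoneda x) (tunit C)
  (day_mk ev (idm y : yoneda y y) (idm x : yoneda x x)).
exists dev, dcoev; apply: yoneda_ext; rewrite /zigzag !day_simpE.
(* The structural isomorphisms of the functor category in terms of their values
   on generators. *)
rewrite -[LHS]/(day_unitl (yoneda x) x (day_hom dev (nt_id _) x
  (day_assoc_inv _ _ _ x (day_hom (nt_id _) dcoev x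
    (day_unitr_inv (yoneda x) x (lidm x)))))).
rewrite day_unitr_invE day_homE.
rewrite -[dcoev _ _]/(pmap (yoneda y ⊛ yoneda x) (idm (tunit C)) _) pmap_id.
rewrite day_assoc_invE day_homE day_unitlE day_liftE !yoneda_mapE.
by rewrite -[RHS]zagzig /pairing !tensm1 !comp1m !compm1.
Qed.

Lemma dual_pairing_sum_yoneda (s : seq C) : left_rigid C ->
  exists Y : psh_cat C, dual_pairing D (sum_yoneda s : psh_cat C) Y.
Proof.
move=> rigidC; elim: s => [|x s [Y dY]]; first exact: dual_pairing_zero.
have [y dxy] := rigidC x.
exists (psh_sum (yoneda y) Y); apply: dual_pairing_sum => //.
exact: dual_pairing_yoneda.
Qed.

Lemma dual_pairing_right_dual (X Y : psh_cat C) :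
  dual_pairing D X Y -> exists Z, is_right_dual D X Z.
Proof.
move=> [ev [coev zz]].
have [Z [r [i [ri ir]]]] := idempotent_split (zagzig_idem zz).
by exists Z; apply: right_dual_split zz ri ir.
Qed.

Lemma day_hom_surj (F G G' : psh C) (t : nat_trans G G') :
  (forall c y, exists x, t c x = y) ->
  forall c w, exists v, day_hom (nt_id F) t c v = w.
Proof.
move=> surj c; elim/day_ind => [|w w' [v <-] [v' <-]|a b f x y].
- by exists 0; rewrite nat_lin0.
- by exists (v + v'); rewrite nat_linD.
- by have [z <-] := surj b y; exists (day_mk f x z); rewrite day_homE.
Qed.

Lemma day_hom_compr (F G G' G'' : psh C) (t : nat_trans G' G'')
    (u : nat_trans G G') c w :
  day_hom (nt_id F) (nt_comp t u) c w
  = day_hom (nt_id F) t c (day_hom (nt_id F) u c w).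
Proof.
have E : day_hom (nt_id F) (nt_comp t u)
    = nt_comp (day_hom (nt_id F) t) (day_hom (nt_id F) u).
  by apply: day_ext => a b d f x y; rewrite [RHS]nt_compE !day_homE.
by rewrite E.
Qed.

(** An element of [(F ⊛ G) c] is a finite sum of generators [(f, x, y)], and each
    [y : G b] is the image of the identity under the map [C(b,-) -> G] that it
    defines. *)
Lemma day_fg_support (F G : psh C) (c : C) (w : (F ⊛ G) c) :
  exists (s : seq C) (p : nat_trans (sum_yoneda s) G) v,
    day_hom (nt_id F) p c v = w.
Proof.
(* Stated for [w0 + w] with [w0] already of this form, so that the induction adds
   one representable at a time. *)
rewrite -[w]add0r.
have : exists (s : seq C) (p : nat_trans (sum_yoneda s) G) v,
  day_hom (nt_id F) p c v = 0 by exists [::], (nt_zero _ _), 0; rewrite nat_lin0.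
move: (0 : (F ⊛ G) c); elim/day_ind: w => [|w w' IH IH'|a b f x y] w0 E.
- by rewrite addr0.
- by rewrite addrA; apply/IH'/IH.
- have [s [p [v <-]]] := E.
  exists (b :: s), (nt_case (yoneda_elt y) p).
  exists (day_hom (nt_id F) (nt_inr _ _) c v
    + day_mk f x (nt_inl (yoneda b) _ b (idm b))).
  rewrite nat_linD day_homE -day_hom_compr; congr (_ + _).
    have -> : nt_comp (nt_case (yoneda_elt y) p) (nt_inr (yoneda b) _) = p.
      apply: nat_trans_eq => d z.
      by rewrite /= (linear_zero (@pmap_linl _ _ G b d y)) add0r.
    by [].
  by congr day_mk; rewrite /= [pmap _ _ _]pmap_id nat_lin0 addr0.
Qed.

Section Adjoint.
Variables (X DX : psh_cat C).
Variable adjX : adjunction (tens_functor D X) (tens_functor D DX).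

(** The correspondence between maps [X -> B], maps [X ⊛ 1 -> B], maps
    [1 -> DX ⊛ B] and elements of [(DX ⊛ B)(1)]. *)
Definition adj_elt (B : psh_cat C) (f : hom X B) : (day DX B) (tunit C) :=
  (adj adjX (f ∘ ihom (munitr D X)) : nat_trans _ _) (tunit C) (idm (tunit C)).

(** The lift [v] is a map [1 -> DX ⊛ A] by the Yoneda lemma, and the factorization
    is its transpose, by naturality of the adjunction. *)
Lemma adj_factor (A B : psh_cat C) (t : hom A B) (f : hom X B) :
  (exists v, day_hom (nt_id DX) t (tunit C) v = adj_elt f) ->
  exists g : hom X A, t ∘ g = f.
Proof.
move=> [v Ev]; pose h := adj adjX (f ∘ ihom (munitr D X)).
pose h' : @hom (psh_cat C) Unit (tens D DX A) := yoneda_elt v.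
have E : fun_hom (tens_functor D DX) t ∘ h' = h.
  apply: yoneda_ext; rewrite -[RHS]/(adj_elt f) -Ev.
  by congr (day_hom _ _ _ _); exact: pmap_id.
exists (adj_inv adjX h' ∘ iinv (munitr D X)).
have E' : t ∘ adj_inv adjX h' = f ∘ ihom (munitr D X).
  apply: (can_inj (@adjK _ _ _ _ adjX _ _)); rewrite -[RHS]/h.
  rewrite -E -[in RHS](adj_invK adjX h').
  rewrite -[RHS]compm1 -adj_nat; congr (adj _ _).
  by rewrite -[fun_hom _ _]/(tensm D (idm X) (idm _)) tensm1 compm1.
by rewrite compA E' -compA iinvK compm1.
Qed.

Lemma adj_projective : projective X.
Proof.
move=> A B t et f; apply: adj_factor.
by apply: day_hom_surj => c y; apply: epi_surj.
Qed.

Lemma adj_finitely_generated : finitely_generated X.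
Proof.
have [s [p pv]] := day_fg_support (adj_elt (idm X)).
have [g pg] := adj_factor pv.
exists s, p => B u v E; rewrite -[u]compm1 -[v]compm1 -pg.
by rewrite [LHS]compA [RHS]compA E.
Qed.

End Adjoint.
End DayDual.

(** * The equivalence *)

Theorem proposition4p25 (k : fieldType) (C : lmoncat k) (rigidC : left_rigid C)
    (X : psh_cat C) :
  let D := day_monoidal C in
  ((exists Y : psh_cat C, is_right_dual D X Y) <->
   (exists DX : psh_cat C,
      right_adjoint (tens_functor D DX) (tens_functor D X))) /\
  ((exists DX : psh_cat C,
      right_adjoint (tens_functor D DX) (tens_functor D X)) <->
   (finitely_generated X /\ projective X)).
Proof.
move=> D.
have i_ii : (exists Y, is_right_dual D X Y) -> exists DX : psh_cat C,
      right_adjoint (tens_functor D DX) (tens_functor D X).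
  by case=> Y dXY; exists Y; apply: right_dual_adjunction.
have ii_iii : (exists DX : psh_cat C,
      right_adjoint (tens_functor D DX) (tens_functor D X)) ->
   finitely_generated X /\ projective X.
  case=> DX [adjX]; split; first exact: adj_finitely_generated adjX.
  exact: adj_projective adjX.
have iii_i : finitely_generated X /\ projective X ->
    exists Y, is_right_dual D X Y.
  move=> [[s [e epi_e]] projX].
  have [g eg] := projX _ _ e epi_e (idm X).
  have [Y dY] := dual_pairing_sum_yoneda s rigidC.
  exact: dual_pairing_right_dual (dual_pairing_retract eg dY).
by split; split; auto.
Qed.
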